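(* Let $m=m(n)$ and $k=k(n)$ be integer functions of $n$ satisfying $4\le m\le\min\{k,n/2\}$ and $k\le n$. Then $\mathbb{E}_m(k,n)=O(n^{-2})$ as $n\to\infty$.
   Context: A $k\times n$ Latin rectangle (with $k\le n$ positive integers) is a $k\times n$ matrix on $n$ symbols (the symbol set is $[n]=\{1,\dots,n\}$), each of which occurs at most once in each row and column; so each row is a permutation of $[n]$. If $k=n$ it is a Latin square of order $n$. A subsquare of order $m$ of a Latin rectangle $L$ is an $m\times m$ submatrix of $L$ (induced by a set of $m$ rows and a set of $m$ columns, not necessarily contiguous) which is itself a Latin square, i.e. contains exactly $m$ distinct symbols. For an integer $2\le m\le n/2$, $\mathbb{E}_m(k,n)$ denotes the expected number of subsquares of order $m$ in a uniformly random $k\times n$ Latin rectangle. Asymptotics are as $n\to\infty$, with $k$ a function of $n$. *)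

(* Defs.v *)
From mathcomp Require Import all_boot all_order all_algebra.
From mathcomp Require Import all_classical all_reals all_analysis.

Set Implicit Arguments.
Unset Strict Implicit.
Unset Printing Implicit Defensive.

Import Order.TTheory GRing.Theory Num.Theory.
Import numFieldNormedType.Exports.

Local Open Scope ring_scope.

(* The symbol set [n] is 'I_n: a symbol occurs at most once in each row and
   column exactly when all rows and columns are injective. *)
Definition is_latin k n (L : 'M['I_n]_(k, n)) : bool :=
  [forall i, injectiveb (fun j => L i j)] &&
  [forall j, injectiveb (fun i => L i j)].

Definition latin_rectangles k n : {set 'M['I_n]_(k, n)} :=
  [set L | is_latin L].

(* A submatrix is given by its set of rows A and its set of columns B. *)
Definition is_subsquare k n (L : 'M['I_n]_(k, n)) (m : nat)
    (AB : {set 'I_k} * {set 'I_n}) : bool :=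
  [&& #|AB.1| == m, #|AB.2| == m
    & #|[set L i j | i in AB.1, j in AB.2]| == m].

Definition nb_subsquares k n (L : 'M['I_n]_(k, n)) (m : nat) : nat :=
  #|[set AB | is_subsquare L m AB]|.

Definition expected_subsquares (R : realType) (m k n : nat) : R :=
  (\sum_(L in latin_rectangles k n) (nb_subsquares L m)%:R)
    / #|latin_rectangles k n|%:R.

(* Main.v *)
(* Switching columns c and c' of a Latin rectangle on the component of a row r
   (the rows reached from r by alternating between equal symbols of the two
   columns) is an involution of the set of Latin rectangles. If c meets a
   subsquare and c' does not, the switch moves a symbol of the subsquare out of
   it. There are n - m choices of c', while undoing the switch requires only the
   cell it emptied and the symbol that was there, so each switch gains a factor
   of order n, as long as it leaves enough of the subsquare intact. A switch may
   hit several rows of the subsquare, but the filling of the subsquare can be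
   exchanged for another one, and a suitable exchange isolates the row r.

   For fixed m, a subsquare that is a relabelled cyclic table is determined by
   two of its columns and one of its rows, even after five of its cells have been
   destroyed; this costs n^3 against a gain of n^5. For large m, about 2 log m
   rows of the subsquare recover its columns from a single one, and some more
   switches than that, in one further row and in distinct columns, keep these
   rows intact. *)
Require Import Defs.
From mathcomp Require Import all_boot perm matrix ssralg zmodp zify ring.

Set Implicit Arguments.
Unset Strict Implicit.
Unset Printing Implicit Defensive.

(** * Switching in two columns *)

Section TwoColumns.
Variables (T : finType) (S : finType).
Implicit Types (f g : T -> S) (X : {set T}).

(** With [f] and [g] injective, thought of as two columns, every component is a path or a cycle of
    rows. *)
Definition adj f g : rel T := fun x y => (g x == f y) || (g y == f x).
Definition component f g r : {set T} := [set y | connect (adj f g) r y].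

Lemma adj_sym f g : symmetric (adj f g).
Proof. by move=> x y; rewrite /adj orbC. Qed.

Lemma component_closed f g r x y : adj f g x y -> (x \in component f g r) = (y \in component f g r).
Proof.
move=> xy; rewrite !inE; have cs := sym_connect_sym (@adj_sym f g).
apply/idP/idP => h; apply: connect_trans h (connect1 _) => //.
by rewrite adj_sym.
Qed.

Lemma component_refl f g r : r \in component f g r.
Proof. by rewrite inE connect0. Qed.

Lemma component_sub f g r (Z : {set T}) : r \in Z ->
  (forall y z, y \in Z -> adj f g y z -> z \in Z) -> component f g r \subset Z.
Proof.
move=> rZ cl; apply/subsetP => y; rewrite inE => /connectP[p pp ->].
elim: p r rZ pp => //= a p IH r rZ /andP[ra pp].
exact: IH (cl _ _ rZ ra) pp.
Qed.

Lemma eq_component f f' g g' r :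
  f =1 f' -> g =1 g' -> component f g r = component f' g' r.
Proof.
move=> ff' gg'; apply/setP=> y; rewrite !inE; apply: eq_connect => u v.
by rewrite /adj !ff' !gg'.
Qed.

(** Inside [Z] the exchange only reverses links, and a link across the boundary of [Z] would equate
    two entries of one original column. This makes switching an involution. *)
Lemma component_switch f g r : injective f -> injective g ->
  let Z := component f g r in
  component (fun x => if x \in Z then g x else f x)
       (fun x => if x \in Z then f x else g x) r = Z.
Proof.
move=> fi gi Z; apply/setP => y; rewrite !inE; apply: eq_connect => {y} x y.
case E: (adj f g x y).
  have := component_closed r E; rewrite -/Z; move: E; rewrite /adj.
  by case: (x \in Z); case: (y \in Z) => // + _; rewrite ![f _ == _]eq_sym orbC.
rewrite /adj; case xZ: (x \in Z); case yZ: (y \in Z).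
- by move: E; rewrite /adj ![f _ == _]eq_sym orbC.
- by rewrite (inj_eq fi) (inj_eq gi); apply: contraFF yZ => /orP[]/eqP; [move=> <-|move=> ->].
- by rewrite (inj_eq fi) (inj_eq gi); apply: contraFF xZ => /orP[]/eqP; [move=> ->|move=> <-].
- by move: E.
Qed.

(* The walk from [r] that alternates between the two columns either returns to
   [X] at some [x], or gets stuck; giving [r] the symbol that closes the walk
   (in the second case, one that no walk started in [X] runs into) separates
   [r] from the rest of [X]. *)
Lemma first_return f g X r : injective f -> injective g -> r \in X ->
  exists2 x, x \in X & forall h, injective h ->
    (forall y, y \notin X -> h y = f y) -> h r = f x ->
    (forall y, y \in X -> h y \in f @: X) ->
    forall y, y \in X -> y \in component h g r -> y = r.
Proof.
move=> fi gi rX.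
(* One step of the walk, leading only to rows outside [X]; it is a partial injection. *)
pose d : rel T := fun x y => (y \notin X) && (f y == g x).
have d_fun x y z : d x y -> d x z -> y = z.
  by case/andP=> _ /eqP fy /andP[_ /eqP fz]; apply: fi; rewrite fy.
have d_inj x y z : d x z -> d y z -> x = y.
  by case/andP=> _ /eqP fx /andP[_ /eqP fy]; apply: gi; rewrite -fx.
have back x y : connect d x y -> y = x \/ exists2 z, connect d x z & d z y.
  case/connectP=> p; elim/last_ind: p y => [|p z _] y /=; first by move=> _ ->; left.
  rewrite rcons_path last_rcons => /andP[pp dz] ->; right.
  by exists (last x p) => //; apply/connectP; exists p.
have fwd x y : connect d x y -> y = x \/ exists2 z, d x z & connect d z y.
  case/connectP=> [[|z p]] /=; first by move=> _ ->; left.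
  by case/andP=> dz pp ->; right; exists z => //; apply/connectP; exists p.
have conX x y : connect d x y -> y \in X -> y = x.
  by case/back => // -[z _ /andP[/negP]].
have meetX x1 x2 y : x1 \in X -> x2 \in X -> connect d x1 y -> connect d x2 y -> x1 = x2.
  move=> x1X x2X /connectP[p]; elim/last_ind: p y => [|p z IH] y /=.
    by move=> _ -> c; rewrite (conX _ _ c).
  rewrite rcons_path last_rcons => /andP[pp dz] -> /back[].
    by move=> zx; case/andP: dz; rewrite zx x2X.
  by case=> w x2w /d_inj/(_ dz) wE; apply: (IH (last x1 p)) => //; rewrite -wE.
have term x y z : connect d x y -> connect d x z ->
    g y \in f @: X -> g z \in f @: X -> y = z.
  have stop u v : g u \in f @: X -> d u v -> False.
    by case/imsetP=> w wX gu /andP[vX]; rewrite gu => /eqP/fi vw; rewrite vw wX in vX.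
  move=> /connectP[p]; elim: p x => [|a p IH] x /=.
    by move=> _ -> /fwd[->//|[w xw _] gx _]; case: (stop _ _ gx xw).
  case/andP=> xa pa yE /fwd[zx|[w xw wz]] gy gz.
    by case: (stop _ a gz); rewrite zx.
  by apply: (IH a) => //; rewrite (d_fun _ _ _ xa xw).
(* For [s] in [f @: X], the step after reaching [s] would re-enter [X]. Restricted to such [s], this
   is a partial injection from [X] to [f @: X]. *)
pose exits x s := [exists y, connect d x y && (g y == s)].
have exits_fun x s1 s2 : s1 \in f @: X -> s2 \in f @: X -> exits x s1 -> exits x s2 -> s1 = s2.
  move=> h1 h2 /existsP[y /andP[xy /eqP ys]] /existsP[z /andP[xz /eqP zs]].
  by rewrite -ys -zs (term x y z) ?ys ?zs.
have exits_inj x1 x2 s : x1 \in X -> x2 \in X -> exits x1 s -> exits x2 s -> x1 = x2.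
  move=> ? ? /existsP[y /andP[xy /eqP<-]] /existsP[z /andP[xz /eqP/gi zy]].
  by apply: (meetX _ _ y); rewrite // -zy.
have [s sX [P1 P2]] : exists2 s, s \in f @: X &
    (forall x, x \in X -> exits x s -> x = r) /\
    (forall s', s' \in f @: X -> exits r s' -> s' = s).
  have [/existsP[s /andP[sX es]]|no] := boolP [exists s, (s \in f @: X) && exits r s].
    exists s => //; split=> [x xX xs|s' s'X rs']; first exact: exits_inj xs es.
    exact: exits_fun rs' es.
  have [/existsP[s /andP[sX /existsPn ne]]|al] := boolP
      [exists s, (s \in f @: X) && ~~ [exists x, (x \in X) && exits x s]].
    exists s => //; split=> [x xX xs|s' s'X rs'].
      by move: (ne x); rewrite xX xs.
    by case/existsP: no; exists s'; rewrite s'X.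
  (* Otherwise every symbol of [f @: X] is the exit of some row of [X] other than [r]: too many
     symbols for too few rows. *)
  exfalso; have : #|f @: X| <= #|X :\ r|.
    pose F s := odflt r [pick x in X | exits x s].
    have FP s : s \in f @: X -> F s \in X /\ exits (F s) s.
      move=> sX; rewrite /F; case: pickP => [x /andP[]//|none].
      case/existsP: al; exists s; rewrite sX /=; apply/negP=> /existsP[x xs].
      by move: (none x); rewrite xs.
    rewrite -(@card_in_imset _ _ F (mem (f @: X))); last first.
      move=> s1 s2 h1 h2 FE; have [_ e1] := FP _ h1; have [_ e2] := FP _ h2.
      by apply: (exits_fun (F s1)) => //; rewrite FE.
    apply: subset_leq_card; apply/subsetP=> _ /imsetP[s sX ->].
    have [FX Fe] := FP _ sX; rewrite !inE FX andbT; apply: contra no => /eqP Fr.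
    by apply/existsP; exists s; rewrite sX -Fr.
  by rewrite card_imset // [#|X|](cardsD1 r) rX ltnn.
have /imsetP[x xX sE] := sX.
exists x => // h hi hf hr hX y yX.
(* Once [r] carries [s], its component stays within its own forward walk and the rows whose walk
   runs into [s]. By [conX] and [P1], both meet [X] at most in [r]. *)
pose Z := [set y | connect d r y || [exists z, connect d y z && (g z == s)]].
have hrs : h r = s by rewrite hr.
suff cZ : component h g r \subset Z.
  move/(subsetP cZ); rewrite inE => /orP[/conX->//|h2]; exact: P1.
apply: component_sub; first by rewrite inE connect0.
move=> u v; rewrite inE => /orP[ru|/existsP[w /andP[uw /eqP gw]]] /orP[]/eqP e.
- have [vX|vX] := boolP (v \in X); last first.
    rewrite inE; apply/orP; left; apply: connect_trans ru (connect1 _).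
    by rewrite /d vX -(hf _ vX) e eqxx.
  have vs : h v = s.
    by apply: P2; [exact: hX|apply/existsP; exists u; rewrite ru e eqxx].
  by have := hi v r; rewrite vs hrs => ->//; rewrite inE connect0.
- case/back: (ru) => [ur|[u0 ru0 /andP[uX /eqP e0]]].
    rewrite inE; apply/orP; right; apply/existsP; exists v.
    by rewrite connect0 e ur hrs eqxx.
  rewrite hf // e0 in e; rewrite (gi _ _ e) inE ru0 //.
- case/fwd: (uw) => [wu|[u1 uu1 u1w]].
    have := hi v r; rewrite hrs -gw wu e => ->//.
    by rewrite inE connect0.
  case/andP: uu1 => u1X /eqP e1.
  have -> : v = u1 by apply: hi; rewrite [h u1]hf // e1 e.
  rewrite inE; apply/orP; right; apply/existsP; exists w.
  by rewrite u1w gw eqxx.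
- have [uX|uX] := boolP (u \in X).
    have ur : u = r by apply: P1 => //; apply/existsP; exists w; rewrite uw gw eqxx.
    rewrite inE; apply/orP; right; apply/existsP; exists v.
    by rewrite connect0 e ur hrs eqxx.
  rewrite inE; apply/orP; right; apply/existsP; exists w; rewrite gw eqxx andbT.
  by apply: connect_trans uw; apply: connect1; rewrite /d uX -(hf _ uX) e eqxx.
Qed.

End TwoColumns.

(** * Switches and conjugates of Latin rectangles *)

Section Rectangles.
Variables k n : nat.
Implicit Types (L : 'M['I_n]_(k, n)) (c j : 'I_n) (r i : 'I_k).

Lemma latinP L : reflect ((forall i, injective (L i)) /\
  (forall j, injective (L^~ j))) (is_latin L).
Proof.
apply: (iffP andP) => -[rows cols]; split.
- by move=> i; apply/injectiveP; exact: (forallP rows).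
- by move=> j; apply/injectiveP; exact: (forallP cols).
- by apply/forallP=> i; apply/injectiveP; exact: rows.
- by apply/forallP=> j; apply/injectiveP; exact: cols.
Qed.

Lemma latin_row L i : is_latin L -> injective (L i).
Proof. by case/latinP. Qed.

Lemma latin_col L j : is_latin L -> injective (L^~ j).
Proof. by case/latinP. Qed.

Definition colcomp L c c' r := component (L^~ c) (L^~ c') r.

Definition switch L c c' r : 'M['I_n]_(k, n) :=
  \matrix_(i, j) L i (if i \in colcomp L c c' r then tperm c c' j else j).

Lemma switch_colE L c c' r : (switch L c c' r)^~ c =1
  fun i => if i \in colcomp L c c' r then L i c' else L i c.
Proof. by move=> i; rewrite mxE tpermL; case: ifP. Qed.

Lemma switch_col'E L c c' r : (switch L c c' r)^~ c' =1
  fun i => if i \in colcomp L c c' r then L i c else L i c'.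
Proof. by move=> i; rewrite mxE tpermR; case: ifP. Qed.

Lemma switch_other L c c' r i j : j != c -> j != c' -> switch L c c' r i j = L i j.
Proof. by move=> jc jc'; rewrite mxE tpermD 1?eq_sym // if_same. Qed.

Lemma switch_notin L c c' r i j : i \notin colcomp L c c' r -> switch L c c' r i j = L i j.
Proof. by move=> iZ; rewrite mxE (negPf iZ). Qed.

Lemma switch_at L c c' r : switch L c c' r r c' = L r c.
Proof. by rewrite switch_col'E component_refl. Qed.

Lemma colcomp_switch L c c' r : is_latin L ->
  colcomp (switch L c c' r) c c' r = colcomp L c c' r.
Proof.
case/latinP=> _ cols; rewrite /colcomp -[RHS]component_switch //.
by apply: eq_component => i; rewrite (switch_colE, switch_col'E).
Qed.

Lemma switchK L c c' r : is_latin L -> switch (switch L c c' r) c c' r = L.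
Proof.
move=> lL; apply/matrixP=> i j; rewrite [LHS]mxE colcomp_switch // mxE.
by case: (i \in colcomp L c c' r) => //; rewrite tpermK.
Qed.

(** Each row is merely permuted. In a column, an entry brought over from the other column cannot
    repeat an entry of a row outside the component, since equality would link the two rows. *)
Lemma switch_latin L c c' r : is_latin L -> is_latin (switch L c c' r).
Proof.
move=> lL; have [rows cols] := latinP _ lL; apply/latinP; split=> [i j j'|].
  by rewrite !mxE => /rows; case: ifP => // _ /perm_inj.
have mix i i' : i \in colcomp L c c' r -> i' \notin colcomp L c c' r ->
    L i c' != L i' c /\ L i c != L i' c'.
  move=> iZ; split; apply: contra H => /eqP e.
    by rewrite -(component_closed r (x := i)) // /adj e eqxx.
  by rewrite -(component_closed r (x := i)) // /adj e eqxx orbT.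
move=> j i i'.
have [-> | jc] := eqVneq j c.
  rewrite !switch_colE; case: ifPn => iZ; case: ifPn => i'Z; try exact: cols.
    by move/eqP; rewrite (negPf (mix _ _ iZ i'Z).1).
  by move/eqP; rewrite eq_sym (negPf (mix _ _ i'Z iZ).1).
have [-> | jc'] := eqVneq j c'.
  rewrite !switch_col'E; case: ifPn => iZ; case: ifPn => i'Z; try exact: cols.
    by move/eqP; rewrite (negPf (mix _ _ iZ i'Z).2).
  by move/eqP; rewrite eq_sym (negPf (mix _ _ i'Z iZ).2).
by rewrite !switch_other //; exact: cols.
Qed.

(* Columns and symbols trade roles, which turns column switches into symbol
   switches. *)
Definition conjugate L : 'M['I_n]_(k, n) := \matrix_(i, s) finv (L i) s.

Lemma conjugateE L i j s : is_latin L -> (conjugate L i s == j) = (L i j == s).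
Proof.
move=> lL; have rows := latin_row lL; rewrite mxE; apply/eqP/eqP => [<-|<-].
  exact: f_finv.
exact: finv_f.
Qed.

Lemma conjugate_cell L i s : is_latin L -> L i (conjugate L i s) = s.
Proof. by move=> lL; apply/eqP; rewrite -conjugateE. Qed.

Lemma cell_conjugate L i j : is_latin L -> conjugate L i (L i j) = j.
Proof. by move=> lL; apply/eqP; rewrite conjugateE. Qed.

Lemma conjugate_latin L : is_latin L -> is_latin (conjugate L).
Proof.
move=> lL.
apply/latinP; split=> [i s s' e|s i i' e].
  by rewrite -(conjugate_cell i s lL) e conjugate_cell.
by apply: (latin_col (j := conjugate L i s) lL); rewrite /= conjugate_cell // e conjugate_cell.
Qed.

Lemma conjugateK L : is_latin L -> conjugate (conjugate L) = L.
Proof.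
move=> lL; apply/matrixP=> i j; apply/eqP.
by rewrite conjugateE ?conjugate_latin // conjugateE.
Qed.

Lemma conjugate_inj : {in [pred L | is_latin L] &, injective conjugate}.
Proof. by move=> L L' lL lL' e; rewrite -(conjugateK lL) e conjugateK. Qed.

End Rectangles.

(** * Subsquares of bounded order *)

Lemma card_sigma (T U : finType) (A : {set T}) (B : T -> {set U}) :
  #|[set p : T * U | (p.1 \in A) && (p.2 \in B p.1)]| = \sum_(x in A) #|B x|.
Proof.
rewrite -sum1dep_card (eq_bigr (fun x => \sum_(y in B x) 1)) => [|x _].
  by rewrite pair_big_dep.
by rewrite sum1_card.
Qed.

(** * Tables embedded in a rectangle, with erased cells *)

Section Frames.
Variables k n m : nat.
Implicit Types (L : 'M['I_n]_(k, n)) (M : 'M['I_m]_m) (H : {set 'I_m * 'I_m}).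

(** Latin tables that coincide on the erased cells put the same set of symbols into the kept cells
    of each row and of each column, so one can replace the other inside a rectangle. *)
Definition agree H M M' := forall a b, (a, b) \in H -> M a b = M' a b.

Lemma agree_row H M M' a b : is_latin M -> is_latin M' -> agree H M M' ->
  (a, b) \notin H -> exists2 b', (a, b') \notin H & M a b' = M' a b.
Proof.
move=> lM lM' MM' abH; have rM := latin_row (i := a) lM.
exists (finv (M a) (M' a b)); last exact: f_finv.
apply: contra abH => b'H; suff <- : finv (M a) (M' a b) = b by [].
by apply: (latin_row (i := a) lM'); rewrite -(MM' _ _ b'H) f_finv.
Qed.

Lemma agree_col H M M' a b : is_latin M -> is_latin M' -> agree H M M' ->
  (a, b) \notin H -> exists2 a', (a', b) \notin H & M a' b = M' a b.
Proof.
move=> lM lM' MM' abH; have cM := latin_col (j := b) lM.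
have fM : M (finv (M^~ b) (M' a b)) b = M' a b by exact: (f_finv cM).
exists (finv (M^~ b) (M' a b)) => //.
apply: contra abH => a'H; suff <- : finv (M^~ b) (M' a b) = a by [].
by apply: (latin_col (j := b) lM'); rewrite /= -(MM' _ _ a'H).
Qed.

(** Labels for the rows, columns and symbols of an abstract table, made injective in [copies]. One
    subsquare can arise from several frames, which is harmless for an upper bound. *)
Definition frame := ({ffun 'I_m -> 'I_k} * ({ffun 'I_m -> 'I_n} * {ffun 'I_m -> 'I_n}))%type.
Implicit Types (F : frame).
Definition fr F : {ffun 'I_m -> 'I_k} := F.1.
Definition fc F : {ffun 'I_m -> 'I_n} := F.2.1.
Definition fs F : {ffun 'I_m -> 'I_n} := F.2.2.

(* [H] is a set of erased cells: a copy of [M] is only required off [H]. *)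
Definition copies M H : {set 'M['I_n]_(k, n) * frame} :=
  [set P | [&& is_latin P.1, injectiveb (fr P.2), injectiveb (fc P.2),
    injectiveb (fs P.2) & [forall a, forall b, ((a, b) \notin H) ==>
      (P.1 (fr P.2 a) (fc P.2 b) == fs P.2 (M a b))]]].

Lemma copiesP M H L F : reflect
  [/\ is_latin L, injective (fr F), injective (fc F), injective (fs F) &
      forall a b, (a, b) \notin H -> L (fr F a) (fc F b) = fs F (M a b)]
  ((L, F) \in copies M H).
Proof.
rewrite inE /=; apply: (iffP and5P) => -[lL rI cI sI e].
  split=> //; [exact/injectiveP | exact/injectiveP | exact/injectiveP | ].
  by move=> a b abH; apply/eqP; move/forallP/(_ a)/forallP/(_ b)/implyP: e; apply.
split=> //; [exact/injectiveP | exact/injectiveP | exact/injectiveP | ].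
by apply/forallP=> a; apply/forallP=> b; apply/implyP=> abH; rewrite e.
Qed.

Definition refill F M H L : 'M['I_n]_(k, n) := \matrix_(i, j)
  if [pick ab | [&& ab \notin H, i == fr F ab.1 & j == fc F ab.2]] is Some ab
  then fs F (M ab.1 ab.2) else L i j.

Lemma refill_in F M H L a b : injective (fr F) -> injective (fc F) ->
  (a, b) \notin H -> refill F M H L (fr F a) (fc F b) = fs F (M a b).
Proof.
move=> rI cI abH; rewrite mxE; case: pickP => [[a' b'] /= | /(_ (a, b))].
  by case/and3P=> _ /eqP/rI -> /eqP/cI ->.
by rewrite /= abH !eqxx.
Qed.

Lemma refillP F M H L i j : injective (fr F) -> injective (fc F) ->
  (exists a b, [/\ (a, b) \notin H, i = fr F a & j = fc F b]) \/
  ((forall a b, (a, b) \notin H -> i = fr F a -> j <> fc F b) /\ refill F M H L i j = L i j).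
Proof.
move=> rI cI; rewrite mxE; case: pickP => [[a b] /= | none].
  by case/and3P=> abH /eqP -> /eqP ->; left; exists a, b.
right; split=> // a b abH ia jb; move: (none (a, b)).
by rewrite /= abH ia jb !eqxx.
Qed.

(** By [agree_row] and [agree_col], a symbol written into a line of the block already stood in a
    kept cell of that line, so it cannot collide with an entry elsewhere on the line. *)
Lemma refill_copies M M' H L F : is_latin M -> is_latin M' -> agree H M M' ->
  (L, F) \in copies M H -> (refill F M' H L, F) \in copies M' H.
Proof.
move=> lM lM' MM' /copiesP[lL rI cI sI LM].
have in_ a b := @refill_in F M' H L a b rI cI.
apply/copiesP; split=> //; apply/latinP; split.
- have mix i j j' a b : (a, b) \notin H -> i = fr F a -> j = fc F b ->
    (forall a b, (a, b) \notin H -> i = fr F a -> j' <> fc F b) ->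
    refill F M' H L i j <> L i j'.
    move=> abH -> -> out; rewrite in_ //.
    have [b' ab'H <-] := agree_row lM lM' MM' abH.
    by rewrite -LM // => /(latin_row lL) /esym; exact: out ab'H _.
  move=> i j j'.
  case: (@refillP F M' H L i j rI cI) => [[a [b [abH ia jb]]]|[o ->]];
  case: (@refillP F M' H L i j' rI cI) => [[a' [b' [abH' ia' jb']]]|[o' e]].
  + move: ia'; rewrite ia jb jb' => /rI aa'; move: abH'; rewrite -aa' => abH'.
    by rewrite !in_ // => /sI /(latin_row lM') ->.
  + by rewrite e => /(mix _ _ _ _ _ abH ia jb o').
  + by move/esym => /(mix _ _ _ _ _ abH' ia' jb' o).
  + by rewrite e => /(latin_row lL).
- have mix i i' j a b : (a, b) \notin H -> i = fr F a -> j = fc F b ->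
    (forall a b, (a, b) \notin H -> i' = fr F a -> j <> fc F b) ->
    refill F M' H L i j <> L i' j.
    move=> abH -> -> out; rewrite in_ //.
    have [a' ab'H <-] := agree_col lM lM' MM' abH.
    rewrite -LM // => /(latin_col lL) /esym i'E; exact: out ab'H i'E _.
  move=> j i i' /=.
  case: (@refillP F M' H L i j rI cI) => [[a [b [abH ia jb]]]|[o ->]];
  case: (@refillP F M' H L i' j rI cI) => [[a' [b' [abH' ia' jb']]]|[o' e]].
  + move: jb'; rewrite jb ia ia' => /cI bb'; move: abH'; rewrite -bb' => abH'.
    by rewrite !in_ // => /sI /(latin_col lM') ->.
  + by rewrite e => /(mix _ _ _ _ _ abH ia jb o').
  + by move/esym => /(mix _ _ _ _ _ abH' ia' jb' o).
  + by rewrite e => /(latin_col lL).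
Qed.

Lemma refillK M M' H L F : (L, F) \in copies M H ->
  refill F M H (refill F M' H L) = L.
Proof.
case/copiesP=> [lL rI cI sI LM]; apply/matrixP=> i j.
case: (@refillP F M H (refill F M' H L) i j rI cI) => [[a [b [abH -> ->]]]|[o ->]].
  by rewrite refill_in ?LM.
case: (@refillP F M' H L i j rI cI) => [[a [b [abH ia jb]]]|[_ ->//]].
by case: (o _ _ abH ia jb).
Qed.

(* Refill the block with [Mf a'], where [a'] comes from [first_return], so that
   the component of row [a] avoids the other kept rows of column [b]; then switch
   column [b] with any of the [n - m] columns outside the block. The outcome
   determines the switch, as it shows where the erased symbol went. *)
Lemma column_step M H a b (Mf : 'I_m -> 'M['I_m]_m) :
  is_latin M -> (a, b) \notin H ->
  (forall a', (a', b) \notin H ->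
    [/\ is_latin (Mf a'), agree H M (Mf a') & Mf a' a b = M a' b]) ->
  exists2 a', (a', b) \notin H &
    #|copies M H| * (n - m) <= m * #|copies (Mf a') ((a, b) |: H)|.
Proof.
move=> lM abH Mfok.
pose D := [set Q : ('M['I_n]_(k, n) * frame) * 'I_n |
  (Q.1 \in copies M H) && (Q.2 \in ~: [set fc Q.1.2 b | b : 'I_m])].
have cardD : #|D| = #|copies M H| * (n - m).
  rewrite /D (card_sigma (copies M H) (fun P => ~: [set fc P.2 b | b : 'I_m])).
  rewrite -sum_nat_const; apply: eq_bigr => -[L F] /copiesP[_ _ cI _ _].
  by rewrite cardsCs setCK card_imset // !card_ord.
pose Phi a' (Q : ('M['I_n]_(k, n) * frame) * 'I_n) :=
  (switch (refill Q.1.2 (Mf a') H Q.1.1) (fc Q.1.2 b) Q.2 (fr Q.1.2 a), Q.1.2).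
pose Da a' := [set Q in D | Phi a' Q \in copies (Mf a') ((a, b) |: H)].
have Da_le a' : (a', b) \notin H -> #|Da a'| <= #|copies (Mf a') ((a, b) |: H)|.
  move=> a'H; have [lM' MM' M'ab] := Mfok _ a'H.
  rewrite -(@card_in_imset _ _ (Phi a') (mem (Da a'))).
    by apply: subset_leq_card; apply/subsetP => _ /imsetP[Q + ->]; rewrite inE => /andP[].
  move=> [[L1 F1] c1] [[L2 F2] c2] /setIdP[+ _] /setIdP[+ _].
  rewrite ![_ \in D]in_set /= => /andP[h1 _] /andP[h2 _].
  rewrite /Phi /= => -[e Fe]; move: h1 h2 e; rewrite {}Fe => h1 h2 e.
  have [_ rI cI sI _] := copiesP _ _ _ _ h1.
  have [lR1 _ _ _ _] := copiesP _ _ _ _ (refill_copies lM lM' MM' h1).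
  have [lR2 _ _ _ _] := copiesP _ _ _ _ (refill_copies lM lM' MM' h2).
  (* After the switch, row [fr F2 a] shows the symbol labelled [M a' b] in the column [c'] that was
     used; this symbol depends only on the frame. *)
  have cc : c1 = c2.
    apply: (latin_row (i := fr F2 a) (switch_latin (fc F2 b) c1 (fr F2 a) lR1)).
    by rewrite switch_at e switch_at !refill_in.
  rewrite cc in e *; congr ((_, _), _).
  rewrite -(refillK (Mf a') h1) -(refillK (Mf a') h2); congr (refill _ _ _ _).
  by rewrite -(switchK (fc F2 b) c2 (fr F2 a) lR1) e switchK.
have D_sub : D \subset \bigcup_(a' | (a', b) \notin H) Da a'.
  apply/subsetP => -[[L F] c'] QD; have := QD; rewrite [_ \in D]in_set /= => /andP[LF].
  rewrite inE => c'F.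
  have [lL rI cI sI LM] := copiesP _ _ _ _ LF.
  pose X := [set fr F a' | a' in [pred a' | (a', b) \notin H]].
  have rX : fr F a \in X by apply/imsetP; exists a.
  have [_ /imsetP[a' a'H ->] sep] := first_return (latin_col (j := fc F b) lL)
    (latin_col (j := c') lL) rX.
  rewrite inE in a'H; have [lM' MM' M'ab] := Mfok _ a'H.
  have LF' := refill_copies lM lM' MM' LF.
  have [lL' _ _ _ LM'] := copiesP _ _ _ _ LF'.
  apply/bigcupP; exists a' => //; rewrite inE QD /Phi /=; apply/copiesP; split=> //.
    exact: switch_latin.
  move=> a1 b1; rewrite !inE negb_or => /andP[ne ab1H].
  have [b1b|b1b] := eqVneq b1 b; last first.
    rewrite switch_other ?LM' ?(inj_eq cI) //.
    by apply: contra c'F => /eqP <-; apply/imsetP; exists b1.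
  rewrite b1b in ne ab1H *; rewrite switch_notin ?LM' //; apply: contra ne => inZ.
  suff /rI -> : fr F a1 = fr F a by rewrite eqxx.
  apply: (sep (refill F (Mf a') H L ^~ (fc F b))).
  - exact: latin_col.
  - move=> y yX; case: (@refillP F (Mf a') H L y (fc F b) rI cI) => [|[]//].
    case=> a2 [b2 [ab2 ya2 /cI bb2]]; case/imsetP: yX; exists a2 => //.
    by rewrite inE bb2.
  - by rewrite LM' // M'ab LM.
  - move=> _ /imsetP[a2 a2H ->]; rewrite inE in a2H; rewrite LM' //.
    have [a3 a3H <-] := agree_col lM lM' MM' a2H.
    by rewrite -LM //; apply: imset_f; apply/imsetP; exists a3.
  - by apply/imsetP; exists a1.
  - have gE : L ^~ c' =1 refill F (Mf a') H L ^~ c'.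
      move=> y; case: (@refillP F (Mf a') H L y c' rI cI) => [|[_ ->]//].
      by case=> a2 [b2 [_ _ c'E]]; case/imsetP: c'F; exists b2.
    by rewrite (eq_component _ (frefl _) gE).
(* At most [m] candidates [a'] share the pairs of [D]; taking the one with the most copies loses the
   factor [m]. *)
case: (@arg_maxnP _ a (fun a' => (a', b) \notin H)
  (fun a' => #|copies (Mf a') ((a, b) |: H)|) abH) => a0 a0H a0max.
exists a0 => //; rewrite -cardD; apply: leq_trans (subset_leq_card D_sub) _.
apply: (@leq_trans (\sum_(a' | (a', b) \notin H) #|Da a'|)).
  elim/big_rec2: _ => [|a' s U _ IH]; first by rewrite cards0.
  by rewrite (leq_trans (leq_card_setU _ _)) // leq_add2l.
apply: (@leq_trans (\sum_(a' | (a', b) \notin H) #|copies (Mf a0) ((a, b) |: H)|)).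
  apply: leq_sum => a' a'H; exact: leq_trans (Da_le _ a'H) (a0max _ a'H).
by rewrite sum_nat_const leq_mul // (leq_trans (max_card _)) ?card_ord.
Qed.

End Frames.

(** * Erasing one more cell by a column or a symbol switch *)

Section Moves.
Variables k n m : nat.
Implicit Types (L : 'M['I_n]_(k, n)) (M : 'M['I_m]_m) (H : {set 'I_m * 'I_m}).
Local Notation copies := (@copies k n m).

Lemma card_copies_agree M M' H : is_latin M -> is_latin M' -> agree H M M' ->
  #|copies M H| <= #|copies M' H|.
Proof.
move=> lM lM' MM'; pose f (P : 'M['I_n]_(k, n) * frame k n m) := (refill P.2 M' H P.1, P.2).
rewrite -(@card_in_imset _ _ f (mem (copies M H))).
  apply: subset_leq_card; apply/subsetP => _ /imsetP[[L F] LF ->].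
  exact: refill_copies LF.
move=> [L1 F1] [L2 F2] h1 h2 [e Fe]; rewrite Fe in h1 e *.
by rewrite -(refillK M' h1) -(refillK M' h2) e.
Qed.

(** The form of [column_step] used below: the symbol [s] is dictated by the count, so a suitable
    table must be available for every symbol not yet erased from column [b]. *)
Lemma column_move M H a b : is_latin M -> (a, b) \notin H ->
  (forall s, (forall a', (a', b) \in H -> M a' b <> s) ->
    exists M', [/\ is_latin M', agree H M M' & M' a b = s]) ->
  exists s M', [/\ forall a', (a', b) \in H -> M a' b <> s,
    is_latin M', agree H M M', M' a b = s &
    #|copies M H| * (n - m) <= m * #|copies M' ((a, b) |: H)|].
Proof.
move=> lM abH ex.
have free a' : (a', b) \notin H -> forall a'', (a'', b) \in H -> M a'' b <> M a' b.
  by move=> a'H a'' a''H /(latin_col lM) e; rewrite e (negPf a'H) in a''H.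
pose Mf a' := odflt M [pick M' | [&& is_latin M', [forall p in H, M p.1 p.2 == M' p.1 p.2]
  & M' a b == M a' b]].
have MfP a' : (a', b) \notin H ->
    [/\ is_latin (Mf a'), agree H M (Mf a') & Mf a' a b = M a' b].
  rewrite /Mf => /free/ex [M' [lM' MM' M'ab]].
  case: pickP => [M'' /and3P[? /forall_inP h /eqP ?]|/(_ M')] /=.
    by split=> // a1 b1 /h /eqP.
  by rewrite lM' M'ab eqxx andbT /= => /forall_inPn[[a1 b1] /MM' ->]; rewrite eqxx.
have [a' a'H le] := @column_step k n m M H a b Mf lM abH MfP.
by have [? ? ?] := MfP _ a'H; exists (M a' b), (Mf a'); split=> //; exact: free.
Qed.

Definition conjugate_cells M H : {set 'I_m * 'I_m} :=
  [set q | (q.1, conjugate M q.1 q.2) \in H].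

Lemma card_copies_conjugate_le M H : is_latin M ->
  #|copies M H| <= #|copies (conjugate M) (conjugate_cells M H)|.
Proof.
move=> lM; pose f (P : 'M['I_n]_(k, n) * frame k n m) : 'M['I_n]_(k, n) * frame k n m :=
  (conjugate P.1, (P.2.1, (P.2.2.2, P.2.2.1))).
rewrite -(@card_in_imset _ _ f (mem (copies M H))).
  apply: subset_leq_card; apply/subsetP => _ /imsetP[[L F] /copiesP[lL rI cI sI LM] ->].
  apply/copiesP; split=> //; first exact: conjugate_latin.
  move=> a s; rewrite inE /= => /LM e; apply/eqP; rewrite conjugateE //.
  by rewrite conjugate_cell // in e; apply/eqP.
move=> [L1 [r1 [c1 s1]]] [L2 [r2 [c2 s2]]] /copiesP[l1 _ _ _ _] /copiesP[l2 _ _ _ _].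
by case=> /conjugate_inj e -> -> ->; rewrite e // inE.
Qed.

Lemma conjugate_cellsK M H : is_latin M ->
  conjugate_cells (conjugate M) (conjugate_cells M H) = H.
Proof.
move=> lM; apply/setP => -[a b]; rewrite !inE /= conjugateK //.
suff -> : conjugate M a (M a b) = b by [].
exact: cell_conjugate.
Qed.

Lemma card_copies_conjugate M H : is_latin M ->
  #|copies (conjugate M) (conjugate_cells M H)| = #|copies M H|.
Proof.
move=> lM; apply/eqP; rewrite eqn_leq card_copies_conjugate_le // andbT.
apply: leq_trans (card_copies_conjugate_le _ (conjugate_latin lM)) _.
by rewrite conjugateK // conjugate_cellsK.
Qed.

(** This is [column_move] in the conjugate: the row and the symbol are chosen, and the column is
    dictated. *)
Lemma symbol_move M H a s : is_latin M -> (forall b, M a b = s -> (a, b) \notin H) ->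
  (forall d, (forall a', (a', d) \in H -> M a' d <> s) ->
    exists M', [/\ is_latin M', agree H M M' & M' a d = s]) ->
  exists d M', [/\ forall a', (a', d) \in H -> M a' d <> s,
    is_latin M', agree H M M', M' a d = s &
    #|copies M H| * (n - m) <= m * #|copies M' ((a, d) |: H)|].
Proof.
move=> lM asH ex.
have lcM := conjugate_latin lM.
have [|d dH|d [N [dH lN MN Nd le]]] := @column_move _ (conjugate_cells M H) a s lcM.
- by rewrite inE /=; apply: asH; rewrite conjugate_cell.
- have [a' a'H a'd|M' [lM' MM' M'd]] := ex d.
    by apply: (dH a'); rewrite ?inE /= -a'd cell_conjugate.
  exists (conjugate M'); split; [exact: conjugate_latin | | by rewrite -M'd cell_conjugate].
  move=> a1 s1; rewrite inE /= => /MM'; rewrite conjugate_cell // => e.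
  by rewrite [in RHS]e cell_conjugate.
have lM' := conjugate_latin lN.
have MM' : agree H M (conjugate N).
  move=> a1 b1 h; apply/esym/eqP; rewrite conjugateE // -MN ?cell_conjugate //.
  by rewrite inE /= cell_conjugate.
have M'd : conjugate N a d = s by rewrite -Nd cell_conjugate.
exists d, (conjugate N); split=> //.
  by move=> a' a'H a'd; apply: (dH a'); rewrite ?inE /= -a'd cell_conjugate.
rewrite -(card_copies_conjugate _ lM) (leq_trans le) // leq_mul2l -(card_copies_conjugate _ lN).
rewrite (_ : conjugate_cells N _ = (a, d) |: H) ?leqnn ?orbT //.
apply/setP => -[a1 b1]; rewrite !inE /= !xpair_eqE; congr orb.
  have [-> /=|//] := eqVneq a1 a; rewrite -M'd; exact: (inj_eq (latin_row lM')).
apply/idP/idP => h; last by rewrite -MM' // cell_conjugate.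
have := MM' _ _ h; rewrite conjugate_cell // => /(latin_row lM') e.
by move: h; rewrite -e.
Qed.

End Moves.

Lemma perm_extend (T : finType) (xs ys : seq T) : uniq xs -> uniq ys ->
  size xs = size ys -> exists s : {perm T}, map s xs = ys.
Proof.
elim: xs ys => [|x xs IH] [|y ys] //=; first by exists 1%g.
case/andP=> xxs uxs /andP[yys uys] [/(IH _ uxs uys)[s sE]].
exists (s * tperm (s x) y)%g; rewrite permM tpermL; congr cons.
rewrite -sE; apply/eq_in_map => z zxs /=; rewrite permM tpermD //.
  by rewrite (inj_eq perm_inj); apply: contraNneq xxs => ->.
by apply: contraNneq yys => ->; rewrite -sE map_f.
Qed.

Lemma exists_notin (T : finType) (xs : seq T) : size xs < #|T| -> exists x, x \notin xs.
Proof.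
move=> lt; apply/existsP; rewrite -negb_forall; apply: contraL lt => /forallP all_in.
rewrite -leqNgt; apply: leq_trans (card_size xs).
by apply/subset_leq_card/subsetP => x _; exact: all_in.
Qed.

(** * Isotopes of the cyclic group table *)

Section CyclicTables.
Variable m' : nat.
Local Notation m := m'.+4.
Import GRing.Theory.
Local Open Scope ring_scope.
Implicit Types (phi psi chi : {perm 'I_m}) (H : {set 'I_m * 'I_m}).

(** An isotope of addition modulo [m]. Having [m] as a fourth successor gives ['I_m] its ring
    structure and makes 0, 1, 2, 3 distinct in it. *)
Definition cyclic_table phi psi chi : 'M['I_m]_m :=
  \matrix_(a, b) chi (phi a + psi b).

Lemma cyclic_table_latin phi psi chi : is_latin (cyclic_table phi psi chi).
Proof.
apply/latinP; split=> [a b b'|b a a']; rewrite !mxE => /perm_inj.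
  by move/addrI/perm_inj.
by move/addIr/perm_inj.
Qed.

(* Columns 2 and 3 trace out all rows and symbols, one after the other, from
   row -2 onwards; the cell in row -2 and column 2 closes the cycle and is not
   needed. *)
Lemma card_copies_cyclic k n phi psi chi H :
  (forall a b, psi b = 2%:R -> phi a != - 2%:R -> (a, b) \notin H) ->
  (forall a b, psi b = 3%:R -> (a, b) \notin H) ->
  (forall b, exists a, (a, b) \notin H) ->
  (#|@copies k n m (cyclic_table phi psi chi) H| <= #|latin_rectangles k n| * (k * n * n))%N.
Proof.
move=> H2 H3 H1; set M := cyclic_table phi psi chi.
pose a0 := (phi^-1)%g (- 2%:R); pose b2 := (psi^-1)%g 2%:R; pose b3 := (psi^-1)%g 3%:R.
pose f (P : 'M['I_n]_(k, n) * frame k n m) :=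
  (P.1, (fr P.2 a0, fc P.2 b2, fc P.2 b3)).
rewrite -(@card_in_imset _ _ f (mem (@copies k n m M H))).
  apply: (@leq_trans #|setX (latin_rectangles k n) [set: 'I_k * 'I_n * 'I_n]|).
    apply/subset_leq_card/subsetP => _ /imsetP[[L F] /copiesP[lL _ _ _ _] ->].
    by rewrite !inE lL.
  by rewrite cardsX cardsT !card_prod !card_ord.
move=> [L [r1 [c1 s1]]] [L' [r2 [c2 s2]]] /copiesP[lL _ _ _ LM1].
move=> /copiesP[_ _ _ _ LM2] [e]; rewrite -{}e in LM2 *.
rewrite /fr /fc /fs /= in LM1 LM2 * => ra0 cb2 cb3.
(* Up to relabelling, column 3 shows the symbol i + 1 in row i - 2, and this symbol in column 2
   locates the row i - 1. *)
have rows (i : nat) : r1 ((phi^-1)%g (i%:R - 2%:R)) = r2 ((phi^-1)%g (i%:R - 2%:R)) /\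
    s1 (chi (i%:R + 1)) = s2 (chi (i%:R + 1)).
  have sym x : r1 ((phi^-1)%g (x - 2%:R)) = r2 ((phi^-1)%g (x - 2%:R)) ->
      s1 (chi (x + 1)) = s2 (chi (x + 1)).
    have := LM1 ((phi^-1)%g (x - 2%:R)) b3; have := LM2 ((phi^-1)%g (x - 2%:R)) b3.
    rewrite !mxE !permKV H3 ?permKV // => /(_ isT) + /(_ isT).
    rewrite -addrA (_ : - 2%:R + 3%:R = 1); last by rewrite addrC [3%:R](natrD _ 1 2) addrK.
    by rewrite -cb3 => <- <- ->.
  elim: i => [|i [IHr IHs]]; first by split; [|apply: sym]; rewrite sub0r.
  suff rE : r1 ((phi^-1)%g (i.+1%:R - 2%:R)) = r2 ((phi^-1)%g (i.+1%:R - 2%:R)).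
    by split=> //; exact: sym.
  (* The numbering has wrapped around to row -2, which is known from the start. *)
  have [i0|i0] := eqVneq (i.+1%:R : 'I_m) 0; first by rewrite i0 sub0r.
  have free : ((phi^-1)%g (i.+1%:R - 2%:R), b2) \notin H.
    by apply: H2; rewrite permKV // -subr_eq0 opprK subrK.
  have := LM1 _ _ free; have := LM2 _ _ free.
  rewrite -mulrSr in IHs; rewrite !mxE !permKV subrK -cb2 -IHs => <-.
  exact: latin_col.
have natE (x : 'I_m) : x = (x : nat)%:R by rewrite (@natr_Zp m'.+2).
have rE : r1 = r2.
  apply/ffunP => a; have [+ _] := rows (phi a + 2%:R : 'I_m).
  by rewrite -natE addrK permK.
have sE : s1 = s2.
  apply/ffunP => z; have [_ +] := rows ((chi^-1)%g z - 1 : 'I_m).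
  by rewrite -natE subrK permKV.
(* Rows and symbols being known, one intact cell per column locates the column. *)
have cE : c1 = c2.
  apply/ffunP => b; have [a ab] := H1 b.
  apply: (latin_row (i := r1 a) lL); rewrite LM1 // [in RHS]rE LM2 //.
  by rewrite sE.
by rewrite rE sE cE.
Qed.

Lemma natr_ord_eq (i j : nat) : (i < m)%N -> (j < m)%N -> (i%:R == j%:R :> 'I_m) = (i == j).
Proof. by move=> hi hj; rewrite !Zp_nat -val_eqE /= !modn_small. Qed.

Lemma natr_ord_opp i : (i <= m)%N -> - i%:R = (m - i)%:R :> 'I_m.
Proof.
move=> im; apply/eqP; rewrite eq_sym -addr_eq0 -natrD subnK // Zp_nat.
by rewrite -val_eqE /= modnn.
Qed.

(** The isotopy is chosen so that the sum at (r3, b3) repeats the one at (r2, c0), the sum at (r2,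
    b2) repeats the one at (r1, c0), and the erased cells spare those that [card_copies_cyclic]
    reads. *)
Lemma cyclic_table_exists (r0 r1 r2 r3 c0 s0 s1 s2 b2 b3 : 'I_m) :
  uniq [:: r0; r1; r2; r3] -> uniq [:: s0; s1; s2] -> b2 != c0 -> b3 != c0 ->
  exists M : 'M['I_m]_m,
  [/\ is_latin M, [/\ M r0 c0 = s0, M r1 c0 = s1 & M r2 c0 = s2], M r3 b3 = s2, M r2 b2 = s1 &
      forall k n, #|@copies k n m M
        ((r2, b2) |: ((r3, b3) |: ((r2, c0) |: ((r1, c0) |: ((r0, c0) |: set0)))))|
      <= #|latin_rectangles k n| * (k * n * n)]%N.
Proof.
move=> ur us b2c b3c.
(* If [b2 = b3], no erased cell lies in the columns numbered 2 and 3. Otherwise [b3] has number 2,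
   and [r3] gets number -2 to make (r3, b3) the one cell of these columns that may be erased. *)
pose rs : seq 'I_m := if b2 == b3 then [:: 2%:R; 1; 0; - 1%:R] else [:: - 1%:R; 1; 0; - 2%:R].
have urs : uniq rs.
  rewrite /rs; case: ifP => _; rewrite /= !inE -[1]/(1%:R) -[0]/(0%:R) !natr_ord_opp //;
  by rewrite !natr_ord_eq //; lia.
pose bs : seq 'I_m := if b2 == b3 then [:: c0; b2] else [:: c0; b2; b3].
have ubs : uniq bs.
  rewrite /bs; case: (eqVneq b2 b3) => [->|b23] /=; rewrite ?inE !(eq_sym c0) (negPf b3c) //.
  by rewrite (negPf b2c) b23.
pose ys : seq 'I_m := if b2 == b3 then [:: 0; 1] else [:: 0; 1; 2%:R].
have uys : uniq ys.
  by rewrite /ys; case: ifP.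
have [phi phiE] : exists phi : {perm 'I_m}, map phi [:: r0; r1; r2; r3] = rs.
  by apply: perm_extend => //; rewrite /rs; case: ifP.
have [psi psiE] : exists psi : {perm 'I_m}, map psi bs = ys.
  by apply: perm_extend => //; rewrite /bs /ys; case: ifP.
have [chi chiE] : exists chi : {perm 'I_m}, map chi (take 3 rs) = [:: s0; s1; s2].
  by apply: perm_extend => //; [exact: take_uniq | rewrite /rs; case: ifP].
have c0b3 : c0 != b3 by rewrite eq_sym.
exists (cyclic_table phi psi chi).
have [rn1 rn2 rn3] : [/\ r1 != r2, r1 != r3 & [/\ r3 != r0, r3 != r1 & r3 != r2]].
  move: ur; rewrite /= !inE !negb_or !(eq_sym r3).
  by case/and4P => /and3P[_ _ ->] /andP[-> ->] -> _.
have row b : exists a, (a, b) \notin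
    (r2, b2) |: ((r3, b3) |: ((r2, c0) |: ((r1, c0) |: ((r0, c0) |: set0)))).
  have [->|bc] := eqVneq b c0.
    exists r3; rewrite !inE !xpair_eqE; case: rn3 => /negPf-> /negPf-> /negPf->.
    by rewrite (negPf c0b3) andbF.
  by exists r1; rewrite !inE !xpair_eqE (negPf rn1) (negPf rn2) (negPf bc) !andbF.
have [p0 p1] : psi c0 = 0 /\ psi b2 = 1.
  by move: psiE; rewrite /bs /ys; case: ifP => _ [].
have ne (i j : nat) : (i < 4)%N -> (j < 4)%N -> i != j -> (i%:R == j%:R :> 'I_m) = false.
  by move=> hi hj ij; rewrite natr_ord_eq ?(negPf ij) //; lia.
have b_c0 b i : (0 < i < 4)%N -> psi b = i%:R -> (b == c0) = false.
  move=> hi pb; apply/negP => /eqP bc; move/eqP: pb.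
  by rewrite bc p0 -[0]/(0%:R) ne //; lia.
have b_b2 b i : (1 < i < 4)%N -> psi b = i%:R -> (b == b2) = false.
  move=> hi pb; apply/negP => /eqP bc; move/eqP: pb.
  by rewrite bc p1 -[1]/(1%:R) ne //; lia.
have vals : [/\ chi (phi r0) = s0, chi (phi r1) = s1 & chi (phi r2) = s2] /\
    [/\ chi (phi r3 + psi b3) = s2, chi (phi r2 + psi b2) = s1 &
    forall a b i, (1 < i < 4)%N -> psi b = i%:R ->
    (a == r3) && (b == b3) -> i = 2%N /\ phi a = - 2%:R].
  rewrite p1; move: phiE psiE chiE; rewrite /rs /bs /ys.
  have [b23|b23] := eqVneq b2 b3 => /= -[-> -> -> ph3] [_ pb2]; last move=> pb3.
    move=> [-> e1 e2]; rewrite e1 e2 add0r -b23 pb2 ph3 addNr; split=> //; split=> // a b i hi pb.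
    by rewrite (b_b2 _ _ hi pb) andbF.
  move=> [-> e1 e2]; rewrite e1 e2 add0r pb3 ph3 addNr; split=> //; split=> // a b i hi pb.
  case/andP=> /eqP-> /eqP bb; split=> //; move/eqP: pb; rewrite bb pb3.
  by apply: contraTeq => i2; rewrite ne //; [lia | rewrite eq_sym].
case: vals => -[e0 e1 e2] [e3 e4 hb].
split; rewrite ?mxE ?p0 ?addr0 //; first exact: cyclic_table_latin.
move=> k n; apply: card_copies_cyclic => //.
  move=> a b pb pa; rewrite !inE !xpair_eqE (b_c0 _ 2) // (b_b2 _ 2) // !andbF !orbF /=.
  by apply: contraNN pa => /(hb a b 2 isT pb)[_ ->].
move=> a b pb; rewrite !inE !xpair_eqE (b_c0 _ 3) // (b_b2 _ 3) // !andbF !orbF /=.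
by apply/negP => /(hb a b 3 isT pb)[].
Qed.
End CyclicTables.

(* Erase (r0,c0), (r1,c0), (r2,c0) by column switches, then the cells of rows
   r3 and r2 with the symbols s2 and s1 by symbol switches. Whatever symbols and
   columns these moves dictate, some cyclic table contains all five cells. *)
Lemma card_copies_full m' k n (M : 'M['I_m'.+4]_m'.+4) : is_latin M ->
  #|@copies k n m'.+4 M set0| * (n - m'.+4) ^ 5 <=
  m'.+4 ^ 5 * (#|latin_rectangles k n| * (k * n * n)).
Proof.
set m := m'.+4 => lM.
have fresh (xs : seq 'I_m) : size xs < 4 -> exists x, x \notin xs.
  by move=> sx; apply: exists_notin; rewrite card_ord (leq_trans sx).
pose r i : 'I_m := inord i.
have rE i j : i < 4 -> j < 4 -> (r i == r j) = (i == j).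
  move=> i4 j4; rewrite -val_eqE /= !inordK //; exact: leq_trans (_ : 4 <= m).
have ur : uniq [:: r 0; r 1; r 2; r 3] by rewrite /= !inE !rE.
pose c0 : 'I_m := ord0.
(* A placeholder for [b2] and [b3] until the moves dictate them. *)
have [b bc] : exists b : 'I_m, b != c0 by have [b] := fresh [:: c0] isT; rewrite inE; exists b.
have ex s0 s1 s2 b2 b3 us h2 h3 :=
  @cyclic_table_exists m' (r 0) (r 1) (r 2) (r 3) c0 s0 s1 s2 b2 b3 ur us h2 h3.
have [||s0 [M0 [_ lM0 _ M0s le0]]] := @column_move k n m M set0 (r 0) c0 lM.
- by rewrite inE.
- move=> s0 _; have [s1] := fresh [:: s0] isT; rewrite !inE => s10.
  have [s2] := fresh [:: s0; s1] isT; rewrite !inE negb_or => /andP[s20 s21].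
  have [|M' [lM' [e0 _ _] _ _ _]] := ex s0 s1 s2 b b _ bc bc.
    by rewrite /= !inE negb_or !(eq_sym s0) s10 s20 eq_sym s21.
  by exists M'; split=> // a1 b1; rewrite inE.
have [||s1 [M1 [s10 lM1 A1 M1s le1]]] := @column_move k n m M0 ((r 0, c0) |: set0) (r 1) c0 lM0.
- by rewrite !inE xpair_eqE rE.
- move=> s1 s10; have {}s10 : s1 != s0.
    by apply/eqP => e; apply: (s10 (r 0)); rewrite ?inE ?eqxx // M0s e.
  have [s2] := fresh [:: s0; s1] isT; rewrite !inE negb_or => /andP[s20 s21].
  have [|M' [lM' [e0 e1 _] _ _ _]] := ex s0 s1 s2 b b _ bc bc.
    by rewrite /= !inE negb_or !(eq_sym s0) s10 s20 eq_sym s21.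
  by exists M'; split=> // a1 b1; rewrite !inE orbF xpair_eqE => /andP[/eqP-> /eqP->]; rewrite M0s.
have {}s10 : s1 != s0.
  by apply/eqP => e; apply: (s10 (r 0)); rewrite ?inE ?eqxx // M0s e.
have M1s0 : M1 (r 0) c0 = s0 by rewrite -A1 ?inE ?eqxx.
have [||s2 [M2 [s2ne lM2 A2 M2s le2]]] :=
  @column_move k n m M1 ((r 1, c0) |: ((r 0, c0) |: set0)) (r 2) c0 lM1.
- by rewrite !inE !xpair_eqE !rE.
- move=> s2 s2ne.
  have s20 : s2 != s0.
    by apply/eqP => e; apply: (s2ne (r 0)); rewrite ?inE ?eqxx ?orbT // M1s0 e.
  have s21 : s2 != s1.
    by apply/eqP => e; apply: (s2ne (r 1)); rewrite ?inE ?eqxx // M1s e.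
  have [|M' [lM' [e0 e1 e2] _ _ _]] := ex s0 s1 s2 b b _ bc bc.
    by rewrite /= !inE negb_or !(eq_sym s0) s10 s20 eq_sym s21.
  exists M'; split=> // a1 b1; rewrite !inE orbF !xpair_eqE.
  by case/orP => /andP[/eqP-> /eqP->]; rewrite ?M1s ?M1s0.
have s20 : s2 != s0.
  by apply/eqP => e; apply: (s2ne (r 0)); rewrite ?inE ?eqxx ?orbT // M1s0 e.
have s21 : s2 != s1.
  by apply/eqP => e; apply: (s2ne (r 1)); rewrite ?inE ?eqxx // M1s e.
have us : uniq [:: s0; s1; s2].
  by rewrite /= !inE negb_or !(eq_sym s0) s10 s20 eq_sym s21.
have M2s0 : M2 (r 0) c0 = s0 by rewrite -A2 ?inE ?eqxx ?orbT.
have M2s1 : M2 (r 1) c0 = s1 by rewrite -A2 ?inE ?eqxx ?orbT.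
pose H3 := (r 2, c0) |: ((r 1, c0) |: ((r 0, c0) |: set0)).
have agree3 (M' : 'M_m) : M' (r 0) c0 = s0 -> M' (r 1) c0 = s1 -> M' (r 2) c0 = s2 -> agree H3 M2 M'.
  move=> e0 e1 e2 a1 b1; rewrite !inE orbF !xpair_eqE.
  by case/or3P => /andP[/eqP-> /eqP->]; rewrite ?M2s ?M2s0 ?M2s1.
(* Column [c0] has [s2] among its erased symbols, so the dictated column cannot be [c0]; the same
   goes for [s1] in the next move. *)
have [||b3 [M3 [b3ne lM3 A3 M3s le3]]] := @symbol_move k n m M2 H3 (r 3) s2 lM2.
- by move=> b1 _; rewrite !inE !xpair_eqE !rE.
- move=> b3 b3ne; have b3c : b3 != c0.
    by apply/eqP => e; apply: (b3ne (r 2)); rewrite ?e ?M2s // !inE eqxx.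
  have [M' [lM' [e0 e1 e2] e3 _ _]] := ex _ _ _ b _ us bc b3c.
  by exists M'; split=> //; exact: agree3.
have b3c : b3 != c0.
  by apply/eqP => e; apply: (b3ne (r 2)); rewrite ?e ?M2s // !inE eqxx.
have M3s0 : M3 (r 0) c0 = s0 by rewrite -A3 ?inE ?eqxx ?orbT.
have M3s1 : M3 (r 1) c0 = s1 by rewrite -A3 ?inE ?eqxx ?orbT.
have M3s2 : M3 (r 2) c0 = s2 by rewrite -A3 ?inE ?eqxx ?orbT.
pose H4 := (r 3, b3) |: H3.
have agree4 (M' : 'M_m) : M' (r 0) c0 = s0 -> M' (r 1) c0 = s1 -> M' (r 2) c0 = s2 ->
    M' (r 3) b3 = s2 -> agree H4 M3 M'.
  move=> e0 e1 e2 e3 a1 b1; rewrite !inE orbF !xpair_eqE.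
  by case/or4P => /andP[/eqP-> /eqP->]; rewrite ?M3s ?M3s2 ?M3s0 ?M3s1.
have [||b2 [M4 [b2ne lM4 A4 M4s le4]]] := @symbol_move k n m M3 H4 (r 2) s1 lM3.
- move=> b1 e; rewrite !inE !xpair_eqE !rE //= orbF; apply/eqP => b1c.
  by move/eqP: s21; rewrite -e b1c M3s2.
- move=> b2 b2ne; have b2c : b2 != c0.
    by apply/eqP => e; apply: (b2ne (r 1)); rewrite ?e ?M3s1 // !inE eqxx !orbT.
  have [M' [lM' [e0 e1 e2] e3 e4 _]] := ex _ _ _ _ _ us b2c b3c.
  by exists M'; split=> //; exact: agree4.
have b2c : b2 != c0.
  by apply/eqP => e; apply: (b2ne (r 1)); rewrite ?e ?M3s1 // !inE eqxx !orbT.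
(* All five cells are fixed by now, and a cyclic table containing them has at least as many
   copies. *)
have [M5 [lM5 [e0 e1 e2] e3 e4 /(_ k n) le5]] := ex _ _ _ _ _ us b2c b3c.
have le6 : #|@copies k n m M4 ((r 2, b2) |: H4)| <= #|@copies k n m M5 ((r 2, b2) |: H4)|.
  apply: card_copies_agree => // a1 b1; rewrite in_setU1 => /orP[|h].
    by rewrite xpair_eqE => /andP[/eqP-> /eqP->]; rewrite M4s.
  by rewrite -A4 //; apply: agree4.
have step x y z j : x * (n - m) <= m * y -> y * (n - m) ^ j <= m ^ j * z ->
    x * (n - m) ^ j.+1 <= m ^ j.+1 * z.
  move=> xy yz; rewrite !expnS mulnA; apply: leq_trans (leq_mul xy (leqnn _)) _.
  by rewrite -!mulnA leq_mul.
apply: (step _ _ _ _ le0); apply: (step _ _ _ _ le1); apply: (step _ _ _ _ le2).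
apply: (step _ _ _ _ le3); apply: (step _ _ _ _ le4).
by rewrite !expn0 muln1 mul1n (leq_trans le6).
Qed.

(** * From subsquares to copies of tables *)

Lemma enum_set_ffun (T : finType) m (A : {set T}) : #|A| = m ->
  exists2 f : {ffun 'I_m -> T}, injective f & [set f i | i : 'I_m] = A.
Proof.
move=> Am; exists [ffun i => enum_val (cast_ord (esym Am) i)].
  by move=> i j; rewrite !ffunE => /enum_val_inj /cast_ord_inj.
apply/setP => x; apply/imsetP/idP => [[i _ ->]|xA]; first by rewrite ffunE enum_valP.
by exists (cast_ord Am (enum_rank_in xA x)) => //; rewrite ffunE cast_ordK enum_rankK_in.
Qed.

Lemma subsquare_copy k n m (L : 'M['I_n]_(k, n)) AB : is_latin L -> is_subsquare L m AB ->
  exists M F, [/\ is_latin M, (L, F) \in @copies k n m M set0 &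
    AB = ([set fr F a | a : 'I_m], [set fc F b | b : 'I_m])].
Proof.
case: AB => A B lL /and3P[/= /eqP Am /eqP Bm /eqP Sm].
have [f fi fA] := enum_set_ffun Am; have [g gi gB] := enum_set_ffun Bm.
have [h hi hS] := enum_set_ffun Sm.
(* The default [a] is never taken, because [h] enumerates all symbols of the subsquare. *)
have hf a b : h (odflt a [pick s | h s == L (f a) (g b)]) = L (f a) (g b).
  case: pickP => [s /eqP //|none].
  have : L (f a) (g b) \in [set h s | s : 'I_m].
    by rewrite hS imset2_f // -?fA -?gB imset_f.
  by case/imsetP=> s _ e; move: (none s); rewrite e eqxx.
exists (\matrix_(a, b) odflt a [pick s | h s == L (f a) (g b)])%R, (f, (g, h)); split.
- apply/latinP; split=> [a b b'|b a a'] /=; rewrite !mxE => /(congr1 h); rewrite !hf.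
    by move/(latin_row lL)/gi.
  by move/(latin_col lL)/fi.
- by apply/copiesP; split=> // a b _; rewrite mxE hf.
- by rewrite /fr /fc /= fA gB.
Qed.

Definition total_subsquares k n m := \sum_(L in latin_rectangles k n) nb_subsquares L m.

Lemma total_subsquares_le k n m :
  total_subsquares k n m <=
  \sum_(M in latin_rectangles m m) #|@copies k n m M set0|.
Proof.
rewrite /total_subsquares -(card_sigma (latin_rectangles k n)
  (fun L => [set AB | is_subsquare L m AB])) -card_sigma.
pose f (Q : 'M['I_m]_m * ('M['I_n]_(k, n) * frame k n m)) :=
  (Q.2.1, ([set fr Q.2.2 a | a : 'I_m], [set fc Q.2.2 b | b : 'I_m])).
apply: leq_trans (leq_imset_card f _).
apply/subset_leq_card/subsetP => -[L AB]; rewrite inE /= inE => /andP[lL].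
rewrite inE => /(subsquare_copy lL)[M [F [lM LF ->]]].
by apply/imsetP; exists (M, (L, F)) => //; rewrite in_set /= LF inE lM.
Qed.

Lemma total_subsquares_fixed m : 4 <= m -> exists C, forall k n, k <= n -> m.*2 <= n ->
  total_subsquares k n m * n ^ 2 <= C * #|latin_rectangles k n|.
Proof.
case: m => [|[|[|[|m']]]] // _; set m := m'.+4.
(* Each of the five switches costs a factor [m], and a factor 2 from [n <= 2 * (n - m)]; the first
   factor is the number of tables. *)
exists (#|latin_rectangles m m| * m ^ 5 * 2 ^ 5) => k n kn mn.
have n0 : 0 < n by lia.
suff : total_subsquares k n m * n ^ 5 <=
    #|latin_rectangles m m| * m ^ 5 * 2 ^ 5 * #|latin_rectangles k n| * n ^ 3.
  by rewrite -[5]/(2 + 3) expnD mulnA leq_pmul2r // expn_gt0 n0.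
have le2 : n ^ 5 <= 2 ^ 5 * (n - m) ^ 5 by rewrite -expnMn leq_exp2r //; lia.
apply: leq_trans (leq_mul (total_subsquares_le k n m) le2) _.
rewrite big_distrl /=.
apply: (@leq_trans (\sum_(M in latin_rectangles m m)
    (2 ^ 5 * (m ^ 5 * (#|latin_rectangles k n| * n ^ 3))))).
  apply: leq_sum => M; rewrite inE => lM.
  rewrite mulnCA leq_mul2l; apply/orP; right.
  apply: leq_trans (card_copies_full k n lM) _; rewrite !leq_mul2l.
  by rewrite (_ : n ^ 3 = n * n * n) ?leq_mul2r ?kn ?orbT // !expnS expn0 muln1 mulnA.
have ac a p q b r : a * (q * (p * (b * r))) = a * p * q * b * r by lia.
by rewrite sum_nat_const ac.
Qed.

(** * Subsquares of large order *)

(** Bernoulli's inequality for (1 + 1/a)^j, cleared of denominators. *)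
Lemma bernoulli_nat a j : a ^ j * (a + j) <= a * a.+1 ^ j.
Proof.
elim: j => [|j IH]; first by rewrite !expn0 muln1 mul1n addn0.
rewrite [a.+1 ^ _]expnSr mulnA; apply: leq_trans (leq_mul IH (leqnn _)).
rewrite expnSr -!mulnA leq_mul2l; apply/orP; right; nia.
Qed.

Lemma double_expn_pred a : 2 * a ^ a.+1 <= a.+1 ^ a.+1.
Proof.
have [->|a0] := posnP a; first by [].
rewrite -(@leq_pmul2l a) // (leq_trans _ (bernoulli_nat a a.+1)) //.
by rewrite mulnA mulnC leq_mul2l; apply/orP; right; lia.
Qed.

(** By [double_expn_pred], every [a.+1] factors a/(a+1) multiply to at most 1/2, so [q] such blocks
    outweigh the factor [a.+1]. *)
Lemma expn_pred_small a q e : a.+1 * q <= e -> a.+1 < 2 ^ q -> a.+1 * a ^ e < a.+1 ^ e.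
Proof.
move=> le_e lt_q.
have q0 : 0 < q by case: q lt_q {le_e}.
have [->|a0] := posnP a; first by rewrite exp0n ?muln0 ?expn_gt0 //; lia.
rewrite -(subnKC le_e) [in ltnLHS]expnD [in ltnRHS]expnD mulnA.
apply: leq_trans _ (leq_mul (leqnn _) (_ : a ^ (e - a.+1 * q) <= _)); last first.
  by case: (e - _) => // s; rewrite leq_exp2r.
rewrite ltn_pmul2r ?expn_gt0 ?a0 //.
apply: (@leq_trans (2 ^ q * a ^ (a.+1 * q))).
  by rewrite ltn_pmul2r // expn_gt0 a0.
by rewrite !expnM -expnMn leq_exp2r // double_expn_pred.
Qed.

Lemma card_setId (T : finType) (A : {set T}) (P : pred T) :
  #|[set x in A | P x]| = \sum_(x in A) P x.
Proof.
by rewrite -sum1dep_card big_mkcondr /=; apply: eq_bigr => x _; case: (P x).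
Qed.

(** * Recovering the columns of a subsquare from a few of its rows *)

Section Generators.
Variables k n m : nat.
Variables (L : 'M['I_n]_(k, n)) (A : {set 'I_k}) (B : {set 'I_n}).

(** Columns are linked by a symbol that both show in rows of [D]. If [D] lies in a subsquare, a
    class started in [B] cannot leave [B], so with enough rows it is [B]. *)
Definition colrel (D : {set 'I_k}) : rel 'I_n := fun c c' =>
  [exists x in D, [exists y in D, L x c == L y c']].

Definition colclass D c := [set c' | connect (colrel D) c c'].

Lemma colrel_sym D : symmetric (colrel D).
Proof.
suff imp c c' : colrel D c c' -> colrel D c' c by move=> c c'; apply/idP/idP; exact: imp.
case/exists_inP=> x xD /exists_inP[y yD /eqP e].
by apply/exists_inP; exists y => //; apply/exists_inP; exists x; rewrite ?e.
Qed.

Lemma colclass_mono (D D' : {set 'I_k}) c : D \subset D' -> colclass D c \subset colclass D' c.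
Proof.
move=> DD'; apply/subsetP => c'; rewrite !inE; apply: connect_sub => c1 c2.
case/exists_inP=> x xD /exists_inP[y yD e]; apply: connect1.
apply/exists_inP; exists x; first exact: (subsetP DD').
by apply/exists_inP; exists y => //; exact: (subsetP DD').
Qed.

Lemma colclass_step D c0 c c' : c \in colclass D c0 -> colrel D c c' -> c' \in colclass D c0.
Proof. by rewrite !inE => h cc'; apply: connect_trans h (connect1 cc'). Qed.

Definition symbols : {set 'I_n} := [set L i j | i in A, j in B].

Hypothesis (lL : is_latin L) (sub : is_subsquare L m (A, B)).

Lemma card_rows : #|A| = m. Proof. by case/and3P: sub => /eqP. Qed.
Lemma card_cols : #|B| = m. Proof. by case/and3P: sub => _ /eqP. Qed.
Lemma card_symbols : #|symbols| = m. Proof. by case/and3P: sub => _ _ /eqP. Qed.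

Lemma row_symbols x : x \in A -> [set L x j | j in B] = symbols.
Proof.
move=> xA; apply/eqP; rewrite eqEcard card_symbols card_imset ?card_cols ?leqnn ?andbT.
  by apply/subsetP => _ /imsetP[j jB ->]; exact: imset2_f.
exact: latin_row.
Qed.

Lemma col_symbols j : j \in B -> [set L i j | i in A] = symbols.
Proof.
move=> jB; apply/eqP; rewrite eqEcard card_symbols (card_imset _ (latin_col lL)) card_rows leqnn andbT.
by apply/subsetP => _ /imsetP[i iA ->]; exact: imset2_f.
Qed.

Lemma mem_symbols_row x j : x \in A -> (L x j \in symbols) = (j \in B).
Proof. by move=> xA; rewrite -(row_symbols xA) mem_imset //; exact: latin_row. Qed.

Lemma mem_symbols_col i j : j \in B -> (L i j \in symbols) = (i \in A).
Proof. by move=> jB; rewrite -(col_symbols jB) (mem_imset _ _ (latin_col lL)). Qed.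

Lemma colclass_sub (D : {set 'I_k}) c : D \subset A -> c \in B -> colclass D c \subset B.
Proof.
move=> DA cB; apply/subsetP => c'; rewrite inE => /connectP[p pp ->].
elim: p c cB pp => //= c1 p IH c cB /andP[cc1]; apply: IH.
case/exists_inP: cc1 => x xD /exists_inP[y yD /eqP e].
by rewrite -(mem_symbols_row (x := y)) ?(subsetP DA) // -e mem_symbols_row ?(subsetP DA).
Qed.

(* Some row sends at least a fraction [1 - w/m] of the class of size [w] to new
   symbols, so the density of the columns still missing is squared. *)
Lemma generator_step (D : {set 'I_k}) c0 r0 : D \subset A -> c0 \in B -> r0 \in D ->
  exists2 r, r \in A &
    (m - #|colclass (r |: D) c0|) * m <= (m - #|colclass D c0|) ^ 2.
Proof.
move=> DA c0B r0D; set W := colclass D c0; have r0A := subsetP DA _ r0D.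
have WB : W \subset B by exact: colclass_sub.
pose T := [set L r0 c | c in W].
have cT : #|T| = #|W| by apply: card_imset; exact: latin_row.
have TS : T \subset symbols.
  by apply/subsetP => _ /imsetP[c cW ->]; rewrite mem_symbols_row // (subsetP WB).
pose J r := [set c in W | L r c \notin T].
(* Double counting: each column of [W] runs through all [m] symbols on the rows [A], and [m - #|W|]
   of them are not in [T]. *)
have sumJ : \sum_(r in A) #|J r| = #|W| * (m - #|W|).
  transitivity (\sum_(r in A) \sum_(c in W) (L r c \notin T)).
    by apply: eq_bigr => r _; rewrite card_setId.
  rewrite exchange_big /= -sum_nat_const; apply: eq_bigr => c cW.
  have cB := subsetP WB _ cW.
  rewrite -card_setId -(card_imset _ (latin_col (j := c) lL)) /=.
  have -> : m - #|W| = #|symbols :\: T| by rewrite cardsD (setIidPr TS) cT card_symbols.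
  apply: eq_card => s.
  apply/imsetP/setDP => [[i]|[sS sT]].
    by rewrite inE => /andP[iA iT] ->; rewrite mem_symbols_col // iA.
  move: sS; rewrite -(col_symbols cB) => /imsetP[i iA si].
  by exists i; rewrite // inE iA -si.
have [r rA rJ] : exists2 r, r \in A & #|W| * (m - #|W|) <= #|J r| * m.
  apply/exists_inP; apply: contraT; rewrite negb_exists_in => /forall_inP h.
  have : \sum_(r in A) (#|J r| * m).+1 <= \sum_(r in A) #|W| * (m - #|W|).
    by apply: leq_sum => r rA; rewrite ltnNge h.
  rewrite sum_nat_const card_rows.
  under eq_bigr => r _ do rewrite -addn1.
  rewrite big_split /= -big_distrl /= sumJ sum1_card card_rows mulnC.
  have : 0 < m by rewrite -card_rows; apply/card_gt0P; exists r0.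
  by move=> m_gt0; rewrite leqNgt -[X in X < _]addn0 ltn_add2l m_gt0.
exists r => //.
(* The columns in which row [r0] shows a symbol that row [r] adds: they are outside [W], but linked
   to it through [r]. *)
pose V := [set c in B | L r0 c \in [set L r c' | c' in J r]].
have VW : #|W :|: V| = #|W| + #|J r|.
  rewrite cardsU (_ : W :&: V = set0) ?cards0 ?subn0.
    congr addn; rewrite -(card_imset _ (latin_row (i := r0) lL)).
    rewrite -(card_imset (mem (J r)) (latin_row (i := r) lL)); apply: eq_card => s.
    apply/imsetP/imsetP => [[c]|[c cJ sE]].
      by rewrite inE => /andP[_ /imsetP[c' c'J ->]] ->; exists c'.
    have cB : c \in B by move: cJ; rewrite inE => /andP[/(subsetP WB)].
    have : L r c \in symbols by rewrite mem_symbols_row.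
    rewrite -(row_symbols r0A) => /imsetP[c1 c1B e1].
    by exists c1; rewrite ?inE ?c1B -?e1 ?sE //=; apply: imset_f.
  apply/setP => c; rewrite !inE; apply/negP => /andP[cW /andP[_ /imsetP[c' c'J e]]].
  move: c'J; rewrite inE -e => /andP[_ /negP]; apply.
  by apply: imset_f; rewrite inE.
have sub' : W :|: V \subset colclass (r |: D) c0.
  have DrD : D \subset r |: D by exact: subsetUr.
  rewrite subUset colclass_mono //=; apply/subsetP => c; rewrite inE => /andP[cB /imsetP[c' c'J e]].
  have c'W : c' \in colclass (r |: D) c0.
    by apply: (subsetP (colclass_mono _ DrD)); move: c'J; rewrite inE => /andP[].
  apply: colclass_step c'W _; apply/exists_inP; exists r; first exact: setU11.
  by apply/exists_inP; exists r0; rewrite ?inE ?r0D ?orbT // e.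
have := subset_leq_card sub'; rewrite VW => le1.
have := subset_leq_card WB; rewrite card_cols => le2.
move: rJ le1 le2; clear; move: #|W| #|J r| #|colclass _ _| => w j w'; nia.
Qed.
End Generators.

(** The density of missing columns starts at 1 - 1/m or less and is squared with each new row. After
    [l.*2] squarings it is below 1/m, so no column is missing. *)
Lemma generators_exist k n m l (L : 'M['I_n]_(k, n)) A B : is_latin L ->
  is_subsquare L m (A, B) -> 0 < m <= 2 ^ l ->
  exists rho : (l.*2.+1).-tuple 'I_k, {subset rho <= A} /\
    forall c, c \in B -> colclass L [set x in rho] c = B.
Proof.
move=> lL sub /andP[m0 ml].
have cA := card_rows sub; have cB := card_cols sub.
have [r0 r0A] : exists r, r \in A by apply/set0Pn; rewrite -card_gt0 cA.
have [c0 c0B] : exists c, c \in B by apply/set0Pn; rewrite -card_gt0 cB.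
have steps j : exists rho : (j.+1).-tuple 'I_k, [/\ {subset rho <= A}, r0 \in rho &
    (m - #|colclass L [set x in rho] c0|) * m ^ (2 ^ j) <= m * m.-1 ^ (2 ^ j)].
  elim: j => [|j [rho [rhoA r0rho le]]].
    exists [tuple r0]; split; [by move=> x; rewrite inE => /eqP->|exact: mem_head|].
    rewrite !expn1 mulnC leq_mul2l; apply/orP; right.
    suff : 0 < #|colclass L [set x in [tuple r0]] c0|.
      by move: #|_| => w; clear -m0; lia.
    by apply/card_gt0P; exists c0; rewrite inE connect0.
  have DA : [set x in rho] \subset A by apply/subsetP => x; rewrite inE; exact: rhoA.
  have r0D : r0 \in [set x in rho] by rewrite inE.
  have [r rA le'] := generator_step lL sub DA c0B r0D.
  exists [tuple of r :: rho]; split.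
  - by move=> x; rewrite inE => /orP[/eqP->//|]; exact: rhoA.
  - by rewrite inE r0rho orbT.
  rewrite (_ : [set x in [tuple of r :: rho]] = r |: [set x in rho]); last first.
    by apply/setP => x; rewrite !inE.
  move: le le'; move: (m - #|_|) (m - #|_|) => u' u le le'.
  rewrite expnS mul2n -addnn !expnD.
  move: le; move: (m ^ _) (m.-1 ^ _) => x y le.
  rewrite -(@leq_pmul2l m) // mulnA [m * u']mulnC.
  apply: leq_trans (leq_mul le' (leqnn (x * x))) _.
  by rewrite -mulnn mulnACA (leq_trans (leq_mul le le)) // mulnACA -mulnA.
have [rho [rhoA r0rho]] := steps l.*2.
set W := colclass _ _ _ => le.
have DA : [set x in rho] \subset A by apply/subsetP => x; rewrite inE; exact: rhoA.
have WB : W \subset B by exact: (colclass_sub lL sub).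
have eW : W = B.
  apply/eqP; rewrite eqEcard WB cB leqNgt; apply/negP => lt_W.
  have lt : m * m.-1 ^ 2 ^ l.*2 < m ^ 2 ^ l.*2.
    rewrite -[m in m * _](prednK m0) -[m in ltnRHS](prednK m0).
    apply: (@expn_pred_small _ (2 ^ l)); rewrite prednK //.
      by rewrite -addnn expnD leq_mul2r ml orbT.
    exact: leq_ltn_trans ml (ltn_expl _ _).
  have := leq_ltn_trans le lt; rewrite ltnNge leq_pmull //.
  by rewrite subn_gt0.
exists rho; split=> // c; rewrite -{1}eW inE => c0c; rewrite -eW.
apply/setP => c'; rewrite !inE; apply/idP/idP; apply: connect_trans => //.
by rewrite (sym_connect_sym (colrel_sym L _)).
Qed.

(** * Exchanging two symbols inside a subsquare *)

Section Recolor.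
Variables k n m : nat.
Variables (L : 'M['I_n]_(k, n)) (A : {set 'I_k}) (B : {set 'I_n}) (s t : 'I_n).

Definition recolor : 'M['I_n]_(k, n) := \matrix_(i, j)
  if (i \in A) && (j \in B) then tperm s t (L i j) else L i j.

Hypothesis (lL : is_latin L) (sub : is_subsquare L m (A, B)).
Hypothesis (sS : s \in symbols L A B) (tS : t \in symbols L A B).

Lemma tperm_symbols x : (tperm s t x \in symbols L A B) = (x \in symbols L A B).
Proof. by case: tpermP => [->|->|//]; rewrite ?sS ?tS. Qed.

Lemma tperm_out x : x \notin symbols L A B -> tperm s t x = x.
Proof. by move=> xS; apply: tpermD; apply: contraNneq xS => <-. Qed.

(** In a row of [A], the symbols [s] and [t] occur only in columns of [B], so the exchange acts as a
    permutation on the whole row; this keeps the rectangle Latin. *)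
Lemma recolor_row i j : i \in A -> recolor i j = tperm s t (L i j).
Proof.
move=> iA; rewrite mxE iA; case: ifPn => // jB.
by rewrite tperm_out // (mem_symbols_row lL sub).
Qed.

Lemma recolor_row_out i j : i \notin A -> recolor i j = L i j.
Proof. by move=> iA; rewrite mxE (negPf iA). Qed.

Lemma recolor_col i j : j \in B -> recolor i j = tperm s t (L i j).
Proof.
move=> jB; rewrite mxE jB andbT; case: ifPn => // iA.
by rewrite tperm_out // (mem_symbols_col lL sub).
Qed.

Lemma recolor_col_out i j : j \notin B -> recolor i j = L i j.
Proof. by move=> jB; rewrite mxE (negPf jB) andbF. Qed.

Lemma recolor_latin : is_latin recolor.
Proof.
apply/latinP; split=> [i j j'|j i i'] /=.
  have [iA|iA] := boolP (i \in A); last by rewrite !recolor_row_out //; exact: latin_row.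
  by rewrite !recolor_row // => /perm_inj; exact: latin_row.
have [jB|jB] := boolP (j \in B); last by rewrite !recolor_col_out //; exact: (latin_col lL).
by rewrite !recolor_col // => /perm_inj; exact: (latin_col lL).
Qed.

Lemma recolor_symbols : symbols recolor A B = symbols L A B.
Proof.
apply/eqP; rewrite eqEcard; apply/andP; split.
  apply/subsetP => _ /imset2P[i j iA jB ->].
  by rewrite recolor_row // tperm_symbols (mem_symbols_row lL sub).
rewrite -(card_imset _ (@perm_inj _ (tperm s t))); apply/subset_leq_card/subsetP => x.
case/imsetP=> _ /imset2P[i j iA jB ->] ->.
by rewrite -recolor_row //; exact: imset2_f.
Qed.

Lemma recolor_subsquare : is_subsquare recolor m (A, B).
Proof.
by move: sub; rewrite /is_subsquare /= -/(symbols recolor A B) recolor_symbols.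
Qed.

(** Links between columns only depend on which entries in the rows [D] are equal. *)
Lemma recolor_colclass (D : {set 'I_k}) c : D \subset A ->
  colclass recolor D c = colclass L D c.
Proof.
move=> DA; apply/setP => c'; rewrite !inE; apply: eq_connect => c1 c2.
apply: eq_existsb => x; have [xD /=|//] := boolP (x \in D).
apply: eq_existsb => y; have [yD /=|//] := boolP (y \in D).
by rewrite !recolor_row ?(subsetP DA) // (inj_eq perm_inj).
Qed.

End Recolor.

(** * Subsquares with recovering rows, and the column pairs whose switch spares these rows *)

Section Configurations.
Variables k n m p : nat.

(* A rectangle, the rows [A] and columns [B] of a subsquare, a row [r] of it,
   and further rows [rho] of it that recover [B] from any column of [B]. *)
Definition config :=
  ('M['I_n]_(k, n) * (({set 'I_k} * {set 'I_n}) * ('I_k * p.-tuple 'I_k)))%type.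

Implicit Type Q : config.
Definition cL Q : 'M['I_n]_(k, n) := Q.1.
Definition cA Q : {set 'I_k} := Q.2.1.1.
Definition cB Q : {set 'I_n} := Q.2.1.2.
Definition cr Q : 'I_k := Q.2.2.1.
Definition crho Q : p.-tuple 'I_k := Q.2.2.2.

Definition is_config Q : bool :=
  [&& is_latin (cL Q), is_subsquare (cL Q) m (cA Q, cB Q), cr Q \in cA Q, cr Q \notin crho Q,
    all (mem (cA Q)) (crho Q) &
    [forall c in cB Q, colclass (cL Q) [set x in crho Q] c == cB Q]].

Definition configs := [set Q | is_config Q].

Definition avoids (L : 'M['I_n]_(k, n)) (r : 'I_k) (rho : seq 'I_k) (q : 'I_n * 'I_n) :=
  all (fun x => x \notin colcomp L q.1 q.2 r) rho.

Definition good_pairs Q : {set 'I_n * 'I_n} :=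
  [set q | [&& q.1 \in cB Q, q.2 \notin cB Q & avoids (cL Q) (cr Q) (crho Q) q]].

(* [first_return] makes any pair good after the exchange of two symbols in the
   subsquare, and such an exchange is undone knowing which of the [p + 1] rows
   [r :: rho] provided the second symbol. *)
Lemma card_good_pairs :
  #|configs| * (m * (n - m)) <= p.+1 * \sum_(Q in configs) #|good_pairs Q|.
Proof.
pose D := [set z : config * ('I_n * 'I_n) |
  (z.1 \in configs) && (z.2 \in setX (cB z.1) (~: cB z.1))].
have <- : #|D| = #|configs| * (m * (n - m)).
  rewrite /D (card_sigma configs (fun Q => setX (cB Q) (~: cB Q))) -sum_nat_const.
  apply: eq_bigr => Q; rewrite inE => /and3P[_ sub _].
  by rewrite cardsX [#|~: _|]cardsCs setCK card_ord (card_cols sub).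
pose G := [set z : config * ('I_n * 'I_n) | (z.1 \in configs) && (z.2 \in good_pairs z.1)].
have <- : #|G| = \sum_(Q in configs) #|good_pairs Q| by exact: card_sigma.
pose X Q : p.+1.-tuple 'I_k := [tuple of cr Q :: crho Q].
pose Phi i (z : config * ('I_n * 'I_n)) : config * ('I_n * 'I_n) :=
  ((recolor (cL z.1) (cA z.1) (cB z.1) (cL z.1 (cr z.1) z.2.1)
      (cL z.1 (tnth (X z.1) i) z.2.1), z.1.2), z.2).
pose Di i := [set z in D | Phi i z \in G].
have XA Q x : Q \in configs -> x \in X Q -> x \in cA Q.
  rewrite inE => /and5P[_ _ rA _ /andP[/allP rhoA _]]; rewrite inE => /orP[/eqP->//|].
  exact: rhoA.
have Di_le i : #|Di i| <= #|G|.
  rewrite -(@card_in_imset _ _ (Phi i) (mem (Di i))).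
    by apply/subset_leq_card/subsetP => _ /imsetP[z + ->] => /setIdP[].
  (* The exchange swaps the two entries that define it, so repeating it with the entries read off
     [L'] undoes it. *)
  have rec Q c c' : (Q, (c, c')) \in D ->
     let s := cL Q (cr Q) c in let t := cL Q (tnth (X Q) i) c in
     let L' := recolor (cL Q) (cA Q) (cB Q) s t in
     recolor L' (cA Q) (cB Q) (L' (cr Q) c) (L' (tnth (X Q) i) c) = cL Q.
    rewrite in_set /= => /andP[QC]; rewrite in_setX /= => /andP[cB' _].
    have := QC; rewrite inE => /and3P[lL sub _].
    rewrite /=; set s := cL Q (cr Q) c; set t := cL Q (tnth _ _) c; set L' := recolor _ _ _ s t.
    have -> : L' (cr Q) c = t by rewrite mxE cB' (XA _ _ QC) ?mem_head // tpermL.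
    have -> : L' (tnth (X Q) i) c = s by rewrite mxE cB' (XA _ _ QC) ?mem_tnth // tpermR.
    by apply/matrixP => i1 j1; rewrite mxE /L' mxE tpermC; case: (_ && _) => //; rewrite tpermK.
  move=> [[L1 [[A1 B1] [r1 h1]]] [c1 c1']] [[L2 [[A2 B2] [r2 h2]]] [c2 c2']].
  move=> /setIdP[/rec e1 _] /setIdP[/rec e2 _] [eL eA eB er eh ec ec'].
  move: e1 e2 eL; rewrite /cL /cA /cB /cr /X /crho /= -eA -eB -er -eh -ec -ec'.
  by move=> e1 e2 eL; rewrite -e1 eL e2.
have D_sub : D \subset \bigcup_(i : 'I_p.+1) Di i.
  apply/subsetP => -[Q [c c']] zD; have := zD; rewrite in_set /= => /andP[QC].
  rewrite in_setX /= => /andP[cB0]; rewrite in_setC => c'B.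
  have := QC; rewrite inE => /and5P[lL sub rA rrho /andP[rhoA /forall_inP gen]].
  pose Xs := [set x in X Q].
  have rXs : cr Q \in Xs by rewrite inE mem_head.
  have XsA x : x \in Xs -> x \in cA Q by rewrite inE; exact: XA.
  have [x xXs sep] := first_return (latin_col (j := c) lL) (latin_col (j := c') lL) rXs.
  have /tnthP[i xi] : x \in X Q by move: xXs; rewrite inE.
  apply/bigcupP; exists i => //; rewrite in_set zD /Phi /= -xi.
  set L' := recolor _ _ _ _ _.
  have sS y : y \in cA Q -> cL Q y c \in symbols (cL Q) (cA Q) (cB Q).
    by move=> yA; rewrite (mem_symbols_row lL sub).
  have rS := sS _ rA; have xS := sS _ (XsA _ xXs).
  have DA : [set x in crho Q] \subset cA Q.
    by apply/subsetP => y; rewrite inE; exact: (allP rhoA).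
  rewrite in_set /=; apply/andP; split.
    rewrite in_set /is_config /cL /cA /cB /cr /crho /= -/(cL Q) -/(cA Q) -/(cB Q) -/(cr Q) -/(crho Q).
    rewrite (recolor_latin lL sub) // (recolor_subsquare lL sub) // rA rrho rhoA /=.
    by apply/forall_inP => c1 c1B; rewrite (recolor_colclass lL sub) // gen.
  rewrite in_set /cL /cB /cr /crho /= -/(cB Q) -/(cr Q) -/(crho Q) cB0 c'B /=.
  apply/allP => y yrho; apply: contra rrho => yZ.
  suff <- : y = cr Q by [].
  have Lc y' : L' y' c = tperm (cL Q (cr Q) c) (cL Q x c) (cL Q y' c).
    exact: (recolor_col lL sub).
  apply: (sep (L' ^~ c)).
  - by apply: latin_col; exact: (recolor_latin lL sub).
  - move=> y' y'X; rewrite Lc tpermD //; apply: contraNneq y'X => /(latin_col lL) <- //.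
  - by rewrite Lc tpermL.
  - move=> y' y'X; rewrite Lc; case: tpermP => [_|_|_ _]; exact: imset_f.
  - by rewrite inE /= inE yrho orbT.
  - have gE : L' ^~ c' =1 cL Q ^~ c' by move=> y'; exact: recolor_col_out.
    by rewrite -(eq_component _ (frefl _) gE).
apply: leq_trans (subset_leq_card D_sub) _.
apply: (@leq_trans (\sum_(i : 'I_p.+1) #|Di i|)).
  elim/big_rec2: _ => [|i s U _ IH]; first by rewrite cards0.
  by rewrite (leq_trans (leq_card_setU _ _)) // leq_add2l.
by rewrite -[p.+1 in leqRHS]card_ord -sum_nat_const; apply: leq_sum.
Qed.

(** A configuration has at most [m * (n - m)] good pairs, and on average at least a fraction 1/(p+1)
    of that; so a fraction 1/(2(p+1)) of the configurations reach half the average guaranteed. *)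
Lemma card_configs_good :
  let G := [set Q in configs | m * (n - m) <= (p.+1).*2 * #|good_pairs Q|] in
  0 < m * (n - m) -> #|configs| <= (p.+1).*2 * #|G|.
Proof.
move=> G pos; have := card_good_pairs; set C := configs; set N := m * (n - m) => le.
have le2 : (p.+1).*2 * \sum_(Q in C) #|good_pairs Q| <= #|C| * N + (p.+1).*2 * (#|G| * N).
  rewrite (bigID (mem G)) /= mulnDr addnC; apply: leq_add.
    rewrite big_distrr /= -sum_nat_const [leqRHS](bigID (mem G)) /= (leq_trans _ (leq_addl _ _)) //.
    by apply: leq_sum => Q /andP[QC]; rewrite [_ \in G]in_set QC -ltnNge => /ltnW.
  rewrite leq_mul2l /= -sum_nat_const.
  rewrite [leqLHS](eq_bigl (mem G)) => [|Q]; last first.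
    by apply/andP/idP => [[]//|QG]; split=> //; case/setIdP: QG.
  apply: leq_sum => Q /setIdP[+ _]; rewrite inE => /and3P[_ sub _].
  apply: (@leq_trans #|setX (cB Q) (~: cB Q)|).
    by apply/subset_leq_card/subsetP => q; rewrite !inE => /and3P[-> ->].
  by rewrite cardsX [#|~: _|]cardsCs setCK card_ord (card_cols sub).
rewrite -(@leq_pmul2r N) //; move: le le2; rewrite -!mul2n -!mulnA.
move: #|C| #|G| (\sum_(_ in _) _) => c g s; nia.
Qed.

End Configurations.

Lemma card_tuple_in (T : finType) (Z : {set T}) t :
  #|[set l : t.-tuple T | all (mem Z) l]| <= #|Z| ^ t.
Proof.
pose f (l : t.-tuple T) := [ffun i => tnth l i].
rewrite -[t in leqRHS](card_ord t) -card_ffun_on.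
rewrite -(@card_in_imset _ _ f (mem [set l : t.-tuple T | all (mem Z) l])).
  apply/subset_leq_card/subsetP => _ /imsetP[l + ->]; rewrite inE => /allP lZ.
  by apply/ffun_onP => i; rewrite ffunE; apply: lZ; exact: mem_tnth.
move=> l1 l2 _ _ /ffunP e; apply: eq_from_tnth => i.
by have := e i; rewrite !ffunE.
Qed.

(** * Ordered matchings in a bipartite graph *)

Section Matchings.
Variables T U : finType.
Implicit Types G : {set T * U}.

Definition matchings G t := [set l : t.-tuple (T * U) |
  [&& all (mem G) l, uniq (map fst l) & uniq (map snd l)]].

(** Greedy choice: fewer than [t] earlier edges block at most [t * (#|T| + #|U|)] edges, which
    leaves [a] choices each time. *)
Lemma card_matchings G a t : a + t * (#|T| + #|U|) <= #|G| -> a ^ t <= #|matchings G t|.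
Proof.
elim: t => [|t IH] le.
  by rewrite expn0 card_gt0; apply/set0Pn; exists [tuple]; rewrite inE.
have {}IH := IH (leq_trans (leq_add (leqnn a) (leq_mul (leqnSn t) (leqnn _))) le).
pose E (l : seq (T * U)) := [set q : T * U | (q.1 \in map fst l) || (q.2 \in map snd l)].
pose D := [set z : t.-tuple (T * U) * (T * U) | (z.1 \in matchings G t) && (z.2 \in G :\: E z.1)].
have le1 : a ^ t.+1 <= #|D|.
  rewrite /D (card_sigma (matchings G t) (fun l => G :\: E l)) expnSr.
  apply: leq_trans (leq_mul IH (leqnn a)) _; rewrite -sum_nat_const.
  apply: leq_sum => l _; rewrite cardsD.
  suff : #|G :&: E l| <= t * (#|T| + #|U|) by move: le; rewrite mulSn; lia.
  apply: leq_trans (subset_leq_card (subsetIr _ _)) _.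
  apply: (@leq_trans #|setX [set x in map fst l] [set: U] :|: setX [set: T] [set x in map snd l]|).
    by apply/subset_leq_card/subsetP => q; rewrite !inE /= andbT.
  apply: leq_trans (leq_card_setU _ _) _; rewrite !cardsX !cardsT !cardsE mulnDr addnC.
  have cs (V : finType) (s : seq V) : size s = t -> #|s| <= t by move=> <-; exact: card_size.
  by apply: leq_add; rewrite ?[#|T| * _]mulnC leq_mul2r cs ?orbT // size_map size_tuple.
apply: leq_trans le1 _.
pose f (z : t.-tuple (T * U) * (T * U)) := [tuple of z.2 :: z.1].
rewrite -(@card_in_imset _ _ f (mem D)).
  apply/subset_leq_card/subsetP => _ /imsetP[[l q] + ->]; rewrite !inE /= negb_or.
  by case/andP=> /and3P[-> -> ->] /andP[/andP[-> ->] ->].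
move=> [l1 q1] [l2 q2] _ _ /(congr1 val) /= [-> e]; congr (_, _); exact: val_inj.
Qed.
End Matchings.

(** * Successive switches in one row and disjoint pairs of columns *)

Section SwitchAll.
Variables k n : nat.
Implicit Types (L : 'M['I_n]_(k, n)) (l : seq ('I_n * 'I_n)).

Definition switch_all r L l := foldl (fun L q => switch L q.1 q.2 r) L l.

Lemma switch_all_latin r L l : is_latin L -> is_latin (switch_all r L l).
Proof. by elim: l L => //= q l IH L lL; apply: IH; exact: switch_latin. Qed.

Lemma switch_allK r L l : is_latin L ->
  foldr (fun q L => switch L q.1 q.2 r) (switch_all r L l) l = L.
Proof.
elim: l L => //= q l IH L lL; rewrite IH ?switch_latin //; exact: switchK.
Qed.

Lemma switch_all_other r L l i j : j \notin map fst l -> j \notin map snd l ->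
  switch_all r L l i j = L i j.
Proof.
elim: l L => //= q l IH L; rewrite !inE !negb_or => /andP[j1 jl1] /andP[j2 jl2].
by rewrite IH // switch_other.
Qed.

(** First columns lie in [B] and second ones outside, so all columns of the list are distinct and no
    switch disturbs another. *)
Lemma switch_all_row r L l (B : {set 'I_n}) q :
  all (fun q => (q.1 \in B) && (q.2 \notin B)) l -> uniq (map fst l) -> uniq (map snd l) ->
  q \in l -> switch_all r L l r q.1 = L r q.2 /\ switch_all r L l r q.2 = L r q.1.
Proof.
elim: l L => //= q' l IH L /andP[/andP[q1B q2B] lB] /andP[u1 ul1] /andP[u2 ul2].
have lB1 j : j \in map fst l -> j \in B.
  by case/mapP=> z /(allP lB)/andP[? _] ->.
have lB2 j : j \in map snd l -> j \notin B.
  by case/mapP=> z /(allP lB)/andP[_ ?] ->.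
rewrite inE => /orP[/eqP->|ql].
  rewrite !switch_all_other //; first by rewrite switch_at switch_colE component_refl.
  - by apply: contra q2B; exact: lB1.
  - by apply: contraL q1B; exact: lB2.
have [-> ->] := IH (switch L q'.1 q'.2 r) lB ul1 ul2 ql.
have /andP[qB1 qB2] := allP lB _ ql.
rewrite !switch_other //.
- by apply: contraNneq u1 => <-; exact: map_f.
- by apply: contraNneq q2B => <-.
- by apply: contraNneq qB2 => ->.
- by apply: contraNneq u2 => <-; exact: map_f.
Qed.

(** Avoidance is assumed in the initial [L] only; it persists because earlier switches leave both
    columns of a later pair, hence its component, unchanged. *)
Lemma switch_all_avoids r L l (rho : seq 'I_k) (B : {set 'I_n}) x j :
  all (fun q => (q.1 \in B) && (q.2 \notin B)) l -> uniq (map fst l) -> uniq (map snd l) ->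
  all (avoids L r rho) l -> x \in rho -> switch_all r L l x j = L x j.
Proof.
move=> + + + + xrho; elim: l L => //= q l IH L /andP[/andP[q1B q2B] lB].
move=> /andP[u1 ul1] /andP[u2 ul2] /andP[avq avl].
rewrite IH //; first by rewrite switch_notin //; exact: (allP avq).
apply/allP => q' q'l; have := allP avl _ q'l; have /andP[q'1 q'2] := allP lB _ q'l.
rewrite /avoids /colcomp (@eq_component _ _ (L ^~ q'.1) ((switch L q.1 q.2 r) ^~ q'.1)
  (L ^~ q'.2) ((switch L q.1 q.2 r) ^~ q'.2)) // => y /=; rewrite switch_other //.
- by apply: contraNneq u1 => <-; exact: map_f.
- by apply: contraNneq q2B => <-.
- by apply: contraNneq q'2 => ->.
- by apply: contraNneq u2 => <-; exact: map_f.
Qed.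

Lemma eq_colclass L L' (D : {set 'I_k}) c : (forall x j, x \in D -> L x j = L' x j) ->
  colclass L D c = colclass L' D c.
Proof.
move=> e; apply/setP => c'; rewrite !inE; apply: eq_connect => c1 c2.
apply: eq_existsb => x; have [xD /=|//] := boolP (x \in D).
by apply: eq_existsb => y; have [yD /=|//] := boolP (y \in D); rewrite !e.
Qed.
End SwitchAll.

(** * Counting configurations by the traces of their switches *)

Section Counting.
Variables k n m p' t' : nat.
Local Notation p := p'.+1.
Local Notation t := t'.+1.
Local Notation cfg := (config k n p).
Local Notation trace :=
  ('M['I_n]_(k, n) * (('I_k * p.-tuple 'I_k) * 'I_n))%type.

(* What the final rectangle, the rows [r], [rho] and one column of the
   subsquare reveal: [B], the symbols, and the columns touched by a switch. *)
Definition traceB (W : trace) := colclass W.1 [set x in W.2.1.2] W.2.2.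
Definition traceS (W : trace) := symbols W.1 [set x in W.2.1.2] (traceB W).
Definition lost (W : trace) := [set c in traceB W | W.1 W.2.1.1 c \notin traceS W].
Definition gained (W : trace) := [set c in ~: traceB W | W.1 W.2.1.1 c \in traceS W].

(** The rows [rho] survive all switches, so they still reveal [B] and the symbols; row [r] then
    betrays the switched columns. As [p] and [t] are successors, there is a row to read symbols from
    and a first pair to supply a column. *)
Lemma traceP (Q : cfg) (l : t.-tuple ('I_n * 'I_n)) :
  Q \in configs k n m p -> l \in matchings (good_pairs Q) t ->
  let W := (switch_all (cr Q) (cL Q) l, ((cr Q, crho Q), (thead l).1)) in
  [/\ traceB W = cB Q, #|lost W| <= t, #|gained W| <= t &
      all (mem (setX (lost W) (gained W))) l].
Proof.
move=> + + W; rewrite inE => /and5P[lL sub rA rrho /andP[/allP rhoA /forall_inP gen]].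
rewrite inE => /and3P[/allP /= lG u1 u2].
have lB : all (fun q => (q.1 \in cB Q) && (q.2 \notin cB Q)) l.
  by apply/allP => q /lG; rewrite inE => /and3P[-> ->].
have av : all (avoids (cL Q) (cr Q) (crho Q)) l.
  by apply/allP => q /lG; rewrite inE => /and3P[].
have rowE x j : x \in [set x in crho Q] -> switch_all (cr Q) (cL Q) l x j = cL Q x j.
  by rewrite inE; exact: (switch_all_avoids _ lB u1 u2 av).
have tB : traceB W = cB Q.
  apply/eqP; rewrite /traceB /= (eq_colclass _ rowE); apply: gen.
  by have /lG := mem_tnth ord0 l; rewrite inE => /and3P[].
have tS : traceS W = symbols (cL Q) (cA Q) (cB Q).
  have x0r := mem_tnth ord0 (crho Q); set x0 := tnth _ _ in x0r.
  rewrite /traceS tB; apply/setP => s; apply/imset2P/idP => [[x j xr jB ->]|].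
    by rewrite /= rowE //; apply: imset2_f => //; apply: rhoA; rewrite inE in xr.
  rewrite -(row_symbols lL sub (rhoA _ x0r)) => /imsetP[j jB ->].
  by exists x0 j => //=; rewrite ?rowE ?inE.
have rowS j : (cL Q (cr Q) j \in traceS W) = (j \in cB Q).
  by rewrite tS (mem_symbols_row lL sub).
have lB1 j : j \in map fst l -> j \in cB Q.
  by case/mapP=> z /(allP lB)/andP[? _] ->.
have lB2 j : j \in map snd l -> j \notin cB Q.
  by case/mapP=> z /(allP lB)/andP[_ ?] ->.
have lostE c : (c \in lost W) = (c \in cB Q) && (W.1 (cr Q) c \notin traceS W).
  by rewrite /lost in_set tB.
have gainedE c : (c \in gained W) = (c \notin cB Q) && (W.1 (cr Q) c \in traceS W).
  by rewrite /gained in_set in_setC tB.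
split=> //.
- apply: (@leq_trans #|[set c in map fst l]|).
    apply/subset_leq_card/subsetP => c; rewrite lostE in_set /= => /andP[cB0]; apply: contraR => cl.
    rewrite switch_all_other ?rowS //.
    by apply: contraL cB0; exact: lB2.
  by rewrite cardsE (leq_trans (card_size _)) // size_map size_tuple.
- apply: (@leq_trans #|[set c in map snd l]|).
    apply/subset_leq_card/subsetP => c; rewrite gainedE in_set /= => /andP[cB0]; apply: contraLR => cl.
    rewrite switch_all_other ?rowS //.
    by apply: contra cB0; exact: lB1.
  by rewrite cardsE (leq_trans (card_size _)) // size_map size_tuple.
- apply/allP => -[c c'] ql; have [/= e1 e2] := switch_all_row (cr Q) (cL Q) lB u1 u2 ql.
  have /andP[/= q1 q2] := allP lB _ ql.
  by rewrite /= in_setX lostE gainedE /= e1 e2 !rowS q1 q2.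
Qed.

(** Pairs of a configuration and a matching are counted twice: from below by [card_matchings], from
    above by trace and list, which together determine the pair. *)
Lemma card_dense_configs (G : {set cfg}) a : G \subset configs k n m p ->
  (forall Q, Q \in G -> a + t * (n + n) <= #|good_pairs Q|) ->
  #|G| * a ^ t <= #|latin_rectangles k n| * (k * k ^ p * n) * (t * t) ^ t.
Proof.
move=> GC dense.
pose D := [set z : cfg * t.-tuple ('I_n * 'I_n) |
  (z.1 \in G) && (z.2 \in matchings (good_pairs z.1) t)].
have le1 : #|G| * a ^ t <= #|D|.
  rewrite /D (card_sigma G (fun Q => matchings (good_pairs Q) t)) -sum_nat_const.
  by apply: leq_sum => Q QG; apply: card_matchings; rewrite card_ord dense.
apply: leq_trans le1 _.
pose W0 : {set trace} := setX (latin_rectangles k n) [set: ('I_k * p.-tuple 'I_k) * 'I_n].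
(* Setting the lists to [set0] for oversized traces keeps the bound [(t * t) ^ t] uniform. *)
pose lists (W : trace) : {set t.-tuple ('I_n * 'I_n)} :=
  if (#|lost W| <= t) && (#|gained W| <= t)
  then [set l : t.-tuple ('I_n * 'I_n) | all (mem (setX (lost W) (gained W))) l] else set0.
pose Y := [set z : trace * t.-tuple ('I_n * 'I_n) | (z.1 \in W0) && (z.2 \in lists z.1)].
have leY : #|Y| <= #|latin_rectangles k n| * (k * k ^ p * n) * (t * t) ^ t.
  rewrite /Y card_sigma; apply: (@leq_trans (\sum_(W in W0) (t * t) ^ t)); last first.
    by rewrite sum_nat_const cardsX cardsT !card_prod card_tuple !card_ord.
  apply: leq_sum => W _; rewrite /lists; case: ifP => [/andP[lt1 lt2]|]; last by rewrite cards0.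
  apply: leq_trans (card_tuple_in _ _) _.
  by rewrite leq_exp2r // cardsX leq_mul.
apply: leq_trans leY.
pose f (z : cfg * t.-tuple ('I_n * 'I_n)) : trace * t.-tuple ('I_n * 'I_n) :=
  ((switch_all (cr z.1) (cL z.1) z.2, ((cr z.1, crho z.1), (thead z.2).1)), z.2).
rewrite -(@card_in_imset _ _ f (mem D)).
  apply/subset_leq_card/subsetP => _ /imsetP[[Q l] + ->].
  rewrite in_set /= => /andP[/(subsetP GC) QC lm].
  have [_ c1 c2 al] := traceP QC lm.
  rewrite in_set /=; apply/andP; split; last by rewrite /lists c1 c2 in_set.
  rewrite in_setX in_setT andbT in_set /= switch_all_latin //.
  by move: QC; rewrite inE => /and3P[].
move=> [Q1 l1] [Q2 l2]; rewrite ![_ \in D]in_set /=.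
move=> /andP[/(subsetP GC) QC1 lm1] /andP[/(subsetP GC) QC2 lm2] [eL er erho ec el].
have [tB1 _ _ _] := traceP QC1 lm1; have [tB2 _ _ _] := traceP QC2 lm2.
have {tB1 tB2} eB : cB Q1 = cB Q2.
  by rewrite -tB1 -tB2 eL er erho ec.
have lL1 : is_latin (cL Q1) by move: QC1; rewrite inE => /and3P[].
have lL2 : is_latin (cL Q2) by move: QC2; rewrite inE => /and3P[].
have {}eL : cL Q1 = cL Q2.
  by rewrite -(switch_allK (cr Q1) l1 lL1) -(switch_allK (cr Q2) l2 lL2) eL er el.
(* Row [r] on [B] gives the symbols, and [A] consists of the rows showing one of them in a column of
   [B]. *)
have eA : cA Q1 = cA Q2.
  have rowA Q j : Q \in configs k n m p -> j \in cB Q ->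
      cA Q = [set x | cL Q x j \in symbols (cL Q) [set cr Q] (cB Q)].
    rewrite inE => /and5P[lL sub rA _ _] jB.
    have symE : symbols (cL Q) [set cr Q] (cB Q) = symbols (cL Q) (cA Q) (cB Q).
      rewrite -(row_symbols lL sub rA); apply/setP => s.
      apply/imset2P/imsetP => [[i i' /set1P -> iB ->]|[i iB ->]]; first by exists i'.
      by exists (cr Q) i; rewrite ?inE.
    by apply/setP => x; rewrite inE symE (mem_symbols_col lL sub).
  have jB1 : (thead l1).1 \in cB Q1.
    move: lm1; rewrite inE => /and3P[/allP/(_ _ (mem_tnth ord0 l1)) /=].
    by rewrite inE => /and3P[].
  rewrite (rowA _ _ QC1 jB1) eL eB er -(rowA _ (thead l1).1 QC2) //.
  by rewrite -eB.
rewrite el; congr (_, _); move: eL er erho eB eA.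
case: Q1 Q2 {QC1 QC2 lm1 lm2 lL1 lL2 ec} => [L1 [[A1 B1] [r1 h1]]] [L2 [[A2 B2] [r2 h2]]].
by rewrite /cL /cr /crho /cB /cA /= => -> -> -> -> ->.
Qed.

End Counting.

(** * Choice of parameters and the bound for large order *)

Lemma total_subsquares_le_configs k n m l : 0 < m <= 2 ^ l -> l.*2.+1 < m ->
  total_subsquares k n m <= #|configs k n m l.*2.+1|.
Proof.
move=> ml lm.
rewrite /total_subsquares -(card_sigma (latin_rectangles k n)
  (fun L => [set AB | is_subsquare L m AB])).
apply: leq_trans (leq_imset_card (fun Q : config k n l.*2.+1 => (Q.1, Q.2.1)) _).
apply/subset_leq_card/subsetP => -[L [A B]]; rewrite !inE /= => /andP[lL sub].
have [rho [rhoA gen]] := generators_exist lL sub ml.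
have [r] : exists r, r \in A :\: [set x in rho].
  apply/set0Pn; rewrite -card_gt0 cardsD subn_gt0 (card_rows sub).
  apply: leq_ltn_trans (subset_leq_card (subsetIr _ _)) _.
  by rewrite cardsE (leq_ltn_trans (card_size _)) // size_tuple.
rewrite !inE => /andP[rrho rA].
apply/imsetP; exists (L, ((A, B), (r, rho))) => //.
rewrite inE; apply/and5P; split=> //.
by apply/andP; split; [apply/allP | apply/forall_inP => c cB'; rewrite /cL /cB /= gen].
Qed.

(** For the parameters [p = 2 * j + 3] and [t = p + 5] chosen below, the left-hand side is 4 (p + 1)
    (t^2 + 2 t), which [m >= 2 ^ j] must dominate. *)
Lemma cubic_le_expn j : 20 <= j -> 32 * ((j + 2) * ((j + 4) * (j + 5))) <= 2 ^ j.
Proof.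
move=> /subnKC <-; elim: (j - 20) => [|i IH].
  by rewrite addn0 -[20 in leqRHS]/(5 + (5 + (5 + 5))) !expnD; do 3 rewrite leq_mul //.
rewrite (addnS 20 i) expnS; apply: leq_trans (leq_mul (leqnn 2) IH).
have : 1 <= 20 + i by []; move: (20 + i) => x x1.
have sq : (x + 3) * (x + 6) <= 2 * ((x + 2) * (x + 4)) by nia.
apply: (@leq_trans (32 * ((x + 5) * ((x + 3) * (x + 6))))); first by apply: eq_leq; lia.
apply: (@leq_trans (32 * ((x + 5) * (2 * ((x + 2) * (x + 4)))))).
  by rewrite !leq_mul2l sq !orbT.
by apply: eq_leq; ring.
Qed.

Lemma total_subsquares_large : exists m0, forall m k n, m0 <= m -> k <= n -> m.*2 <= n ->
  total_subsquares k n m * n ^ 2 <= #|latin_rectangles k n|.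
Proof.
exists (2 ^ 20) => m k n m_large kn mn.
have m0 : 0 < m by apply: leq_trans m_large; rewrite expn_gt0.
have /andP[lo hi] := trunc_log_bounds (isT : 1 < 2) m0.
have j20 := trunc_log_max (isT : 1 < 2) m_large.
move: (trunc_log 2 m) lo hi j20 => j lo hi /cubic_le_expn/leq_trans/(_ lo) {m_large lo} cubic.
(* [m < 2 ^ j.+1] gives [l]. The trace costs at most [n ^ (p + 2)], and [n ^ t] exceeds this by
   [n ^ 3]; one more [n] pays for the factor [(p.+1).*2]. *)
pose l := j.+1; pose p := l.*2.+1; pose t := p.+1 + 4.
have params : 4 * (p.+1 * (t * t + 2 * t)) <= m.
  by apply: leq_trans cubic; rewrite /t /p /l; lia.
have p_lt : (p.+1).*2 <= m by apply: leq_trans params; nia.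
have n0 : 0 < n by lia.
set N := m * (n - m).
have N_ge : m * n <= N * 2 by rewrite /N -mulnA leq_mul2l; apply/orP; right; lia.
have N0 : 0 < N by rewrite muln_gt0 m0 subn_gt0; lia.
have le1 : total_subsquares k n m <= #|configs k n m p|.
  apply: total_subsquares_le_configs; first by rewrite m0 ltnW.
  by rewrite -/p; lia.
have := leq_trans le1 (@card_configs_good k n m p N0).
set G := [set Q in _ | _] => {}le1.
(* Taking [a = t * t * n] cancels the factor [(t * t) ^ t] for the lists. *)
have dense : #|G| * (t * t * n) ^ t <= #|latin_rectangles k n| * (k * k ^ p * n) * (t * t) ^ t.
  have := @card_dense_configs k n m l.*2 (p + 4) G (t * t * n).
  rewrite -addSn -/t -/p; apply; first by apply/subsetP => Q /setIdP[].
  move=> Q /setIdP[_]; rewrite -/N => good.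
  rewrite -(@leq_pmul2l (p.+1).*2) // (leq_trans _ good) //.
  rewrite -(@leq_pmul2r 2) // (leq_trans _ N_ge) //.
  apply: leq_trans (leq_mul params (leqnn n)); rewrite -!muln2.
  by apply: eq_leq; ring.
have {dense} : #|G| * n ^ 3 <= #|latin_rectangles k n|.
  have tt0 : 0 < (t * t) ^ t by rewrite expn_gt0.
  move: dense; rewrite expnMn mulnA mulnAC leq_pmul2r // => dense.
  have np0 : 0 < n ^ (p + 2) by rewrite expn_gt0 n0.
  rewrite -(@leq_pmul2r (n ^ (p + 2))) // -mulnA -expnD.
  have -> : 3 + (p + 2) = t by rewrite /t; lia.
  apply: leq_trans dense _; rewrite leq_mul2l; apply/orP; right.
  by rewrite -expnS addn2 [in leqRHS]expnSr leq_mul2r leq_exp2r // kn orbT.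
move=> dense; apply: leq_trans dense; rewrite (expnS n 2) [n * _]mulnC mulnA.
rewrite [#|G| * _ * n]mulnAC leq_mul2r; apply/orP; right.
apply: leq_trans le1 _; rewrite mulnC leq_mul2l; apply/orP; right; lia.
Qed.

(** The finitely many orders below the threshold have constants of their own, which are added up. *)
Lemma total_subsquares_bound : exists C, forall m k n, 4 <= m -> k <= n -> m.*2 <= n ->
  total_subsquares k n m * n ^ 2 <= C * #|latin_rectangles k n|.
Proof.
have [m0 large] := total_subsquares_large.
have [C small] : exists C, forall m k n, m < m0 -> 4 <= m -> k <= n -> m.*2 <= n ->
    total_subsquares k n m * n ^ 2 <= C * #|latin_rectangles k n|.
  elim: m0 {large} => [|m0 [C IH]]; first by exists 0.
  have [m0_small|/total_subsquares_fixed[D fixed]] := ltnP m0 4.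
    exists C => m k n; rewrite ltnS leq_eqVlt => /orP[/eqP->|lt].
      by rewrite leqNgt m0_small.
    exact: IH.
  exists (C + D) => m k n; rewrite ltnS leq_eqVlt mulnDl => /orP[/eqP->|lt] m4 kn mn.
    by apply: leq_trans (leq_addl _ _); exact: fixed.
  by apply: leq_trans (leq_addr _ _); exact: IH.
exists C.+1 => m k n m4 kn mn; rewrite mulSn.
have [lt|le] := ltnP m m0; first by apply: leq_trans (leq_addl _ _); exact: small.
by apply: leq_trans (leq_addr _ _); exact: large.
Qed.

(* The asymptotic bound for the expectation *)
From mathcomp Require Import all_boot all_order all_algebra.
From mathcomp Require Import all_classical all_reals all_analysis.
Import Order.TTheory GRing.Theory Num.Theory.
Import numFieldNormedType.Exports.
Local Open Scope classical_set_scope.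
Local Open Scope ring_scope.

Lemma expected_subsquaresE (R : realType) m k n : expected_subsquares R m k n =
  (total_subsquares k n m)%:R / #|latin_rectangles k n|%:R.
Proof. by rewrite /expected_subsquares /total_subsquares natr_sum. Qed.

Theorem theorem1p1 (R : realType) (m k : nat -> nat)
    (hmk : \forall n \near \oo,
       (4 <= m n <= minn (k n) n./2)%N /\ (k n <= n)%N) :
  (fun n : nat => expected_subsquares R (m n) (k n) n)
    =O_\oo (fun n : nat => n%:R ^- 2 : R).
Proof.
have [C bound] := total_subsquares_bound.
(* The successor makes the constant positive. *)
apply/eqO_exP; exists C.+1%:R; first by rewrite ltr0n.
move: hmk; apply: filterS2 (nbhs_infty_gt 0) => n n_gt0 [/andP[m4 mk] kn].
have mn : ((m n).*2 <= n)%N by lia.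
rewrite expected_subsquaresE !ger0_norm ?invr_ge0 ?exprn_ge0 ?divr_ge0 ?ler0n //.
(* With no rectangles the quotient is 0, as the inverse of 0 is 0. *)
have [->|om_gt0] := posnP #|latin_rectangles (k n) n|.
  by rewrite invr0 mulr0 mulr_ge0 ?invr_ge0 ?exprn_ge0 ?ler0n.
rewrite ler_pdivlMr ?exprn_gt0 ?ltr0n // mulrAC ler_pdivrMr ?ltr0n //.
rewrite -natrX -!natrM ler_nat (leq_trans (bound _ _ _ m4 kn mn)) //.
by rewrite leq_mul2r leqnSn orbT.
Qed.
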